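(* Let $-\infty\le a<b\le\infty$, let $n\ge 2$ be an integer, let $w=e^{-Q}$ be an admissible, approximating weight on $(a,b)$, and let $x_1,\dots,x_n\in(a,b)$ be distinct. (i) If $\left(\frac1w\right)^{(2n)}\ge 0$ on $(a,b)$, then the following are equivalent: (A) $C_{k,w}=0$ for $k=1,\dots,n$; (B) $\{x_1,\dots,x_n\}$ is the $n$-th weighted Fekete set $\mathcal F_{n,w^{1/(2(n-1))}}$ associated with $w^{\frac1{2(n-1)}}$; (D) $Y_{n,w}$ (i.e. the interpolatory system $l_1^2,\dots,l_n^2$) is $w$-stable and most economical; (E) $\{x_1,\dots,x_n\}$ is $1(w)$-normal. (ii) Let $w_n=\frac{w\varrho_n}{A_n}$ and assume that $w_n$ is an approximating weight on $(a,b)$. If $\left(\frac1{w_n}\right)^{(2n)}\ge 0$ on $(a,b)$, then the following are equivalent: (A$'$) $C_{k,w_n}=0$ for $k=1,\dots,n$; (B$'$) $\{x_1,\dots,x_n\}$ is the $n$-th weighted Fekete set $\mathcal F_{n,w_n^{1/(2(n-1))}}$ associated with $w_n^{\frac1{2(n-1)}}$; (C) $p_{n,w}(x_k)=0$ for $k=1,\dots,n$; (D$'$) $Y_{n,w_n}$ (i.e. the interpolatory system $l_1^2,\dots,l_n^2$) is $w_n$-stable and most economical; (E$'$) $\{x_1,\dots,x_n\}$ is $1(w_n)$-normal.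
   Context: Weights. A weight $v$ on the closure $\Sigma$ of $(a,b)$ in $\mathbb{R}$ is admissible if it is nonnegative and upper semicontinuous, if $|x|v(x)\to 0$ as $|x|\to\infty$, $x\in\Sigma$ (when $\Sigma$ is unbounded), and if $\{x\in\Sigma: v(x)>0\}$ has positive logarithmic capacity. An admissible weight $v$ is approximating on $(a,b)$ if it has finite moments, it is twice differentiable with $\left(\log\frac1v\right)''\ge 0$ on $(a,b)$, and $\lim_{x\to a+}\frac{v(x)}{x-a}=0$ if $a$ is finite, $\lim_{x\to b-}\frac{v(x)}{b-x}=0$ if $b$ is finite. The conditions on $(1/v)^{(2n)}$ include that this derivative exists on $(a,b)$. Notation for nodes. $\omega(x)=\prod_{k=1}^n(x-x_k)$ and $l_k(x)=\frac{\omega(x)}{\omega'(x_k)(x-x_k)}$. For a weight $v$ the Fejér constants are $C_{k,v}=\frac{\omega''(x_k)}{\omega'(x_k)}+\frac{v'(x_k)}{v(x_k)}$, and $Y_{n,v}(x)=v(x)\sum_{k=1}^n\frac{l_k^2(x)}{v(x_k)}$. Fekete sets. $\{x_1,\dots,x_n\}$ is an $n$-th weighted Fekete set associated with a weight $u$ if the supremum over $z_1,\dots,z_n\in(a,b)$ of $\left(\prod_{1\le i<j\le n}|z_i-z_j|\,u(z_i)u(z_j)\right)^{\frac{2}{n(n-1)}}$ is attained at $(x_1,\dots,x_n)$. Orthogonal polynomials and $w_n$. $p_{n,w}(x)=\gamma_nx^n+\dots$ ($\gamma_n>0$) is the $n$-th orthonormal polynomial with respect to $w$ on $(a,b)$,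 i.e. $\int_a^bp_{n,w}p_{m,w}w=\delta_{nm}$; $\varrho_n=\gamma_{n-1}/\gamma_n$; and $$A_n(x)=\varrho_n\int_a^bp_{n,w}^2(t)w(t)\frac{Q'(t)-Q'(x)}{t-x}\,dt .$$ Stability. An interpolatory system for the nodes $x_1,\dots,x_n$ is a family of polynomials $\hat l_1,\dots,\hat l_n$ (of arbitrary degrees) with $\hat l_k(x_i)=\delta_{ki}$. It is $v$-stable on $(a,b)$ if for all $y_1,\dots,y_n\ge 0$ and all $x\in(a,b)$, $0\le v(x)\sum_{k=1}^n\frac{\hat l_k(x)}{v(x_k)}y_k\le\max_ky_k$. A $v$-stable system is most economical if $\sum_{k=1}^n\deg\hat l_k$ is minimal among all $v$-stable interpolatory systems. $1(v)$-normality. $\{x_1,\dots,x_n\}$ is $1(v)$-normal if there is an $L>1$ such that $|x_k|<La_n$ for all $k$, where $a_n>0$ is the Mhaskar–Rakhmanov–Saff number of the weight, and $v(x)\sum_{k=1}^n\frac{l_k^2(x)}{v(x_k)}\le 1$ for all $x\in(a,b)$. Since here $n$ is fixed and $L$ is arbitrary, the first requirement imposes no restriction. *)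

(* Defs.v *)
From HB Require Import structures.
From mathcomp Require Import all_boot all_order all_algebra.
From mathcomp Require Import all_classical all_reals all_analysis.
Set Implicit Arguments.
Unset Strict Implicit.
Unset Printing Implicit Defensive.
Import Order.TTheory GRing.Theory Num.Theory.
Import numFieldNormedType.Exports.
Local Open Scope classical_set_scope.
Local Open Scope ring_scope.

Definition opitv (R : realType) (a b : \bar R) : set R :=
  [set t : R | (a < t%:E)%E /\ (t%:E < b)%E].

(* Logarithmic energy; the kernel is [+oo] on the diagonal since
   [lne 0 = -oo]. *)
Definition log_energy (R : realType)
    (mu : probability (measurableTypeR R) R) : \bar R :=
  (\int[mu]_s \int[mu]_t (- lne `|s - t|%:E))%E.

(* [cap E = exp (- V)], where the Robin constant [V] is the infimum of the
   energies of the probability measures carried by a compact subset of [E];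
   without such a measure, or if [V = +oo], the capacity is 0. *)
Definition log_capacity (R : realType) (E : set R) : \bar R :=
  expeR (- ereal_inf [set log_energy mu | mu in
    [set mu : probability (measurableTypeR R) R |
      exists K : set R, [/\ compact K, K `<=` E & mu K = 1%E]]])%E.

(* A weight is a total function of which only the values on the closure of
   the interval are constrained. *)
Record admissible (R : realType) (a b : \bar R) (v : R -> R) : Prop :=
  Admissible {
    admissible_ge0 : forall t, closure (opitv a b) t -> 0 <= v t ;
    admissible_usc : forall t, closure (opitv a b) t ->
      forall c, v t < c ->
      \forall s \near within (closure (opitv a b)) (nbhs t), v s < c ;
    admissible_decay : forall e, 0 < e ->
      exists M : R, forall t, closure (opitv a b) t -> M < `|t| ->
        `|t| * v t < e ;
    admissible_capacity :
      (0 < log_capacity (closure (opitv a b) `&` [set t | (0 < v t)%R]))%E }.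

(* Positivity on the open interval is what makes [log (1/v)] a real-valued
   function there; it has to be stated because [ln 0 = 0]. *)
Record approximating (R : realType) (a b : \bar R) (v : R -> R) : Prop :=
  Approximating {
    approximating_admissible : admissible a b v ;
    approximating_moments : forall k : nat,
      (@lebesgue_measure R).-integrable (opitv a b)
        (fun t => (`|t| ^+ k * v t)%:E) ;
    approximating_gt0 : forall t, opitv a b t -> 0 < v t ;
    approximating_derivable : forall t, opitv a b t ->
      derivable v t 1 /\ derivable (derive1 v) t 1 ;
    approximating_logconcave : forall t, opitv a b t ->
      0 <= derive1n 2 (fun s => ln (v s)^-1) t ;
    approximating_left : forall r : R, a = r%:E ->
      v t / (t - r) @[t --> r^'+] --> (0 : R) ;
    approximating_right : forall r : R, b = r%:E ->
      v t / (r - t) @[t --> r^'-] --> (0 : R) }.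

(* [f^(m) >= 0] on (a, b), including the existence of [f^(m)] there. *)
Definition nderiv_ge0 (R : realType) (a b : \bar R) (m : nat) (f : R -> R) :=
  forall t, opitv a b t ->
    (forall k, (k < m)%N -> derivable (derive1n k f) t 1) /\
    0 <= derive1n m f t.

Section Nodes.
Variables (R : realType) (n : nat) (x : 'I_n -> R).

Definition omega : {poly R} := \prod_(k < n) ('X - (x k)%:P).

Definition fund (k : 'I_n) : {poly R} :=
  omega %/ ((deriv omega).[x k] *: ('X - (x k)%:P)).

Definition fejer_const (v : R -> R) (k : 'I_n) : R :=
  (deriv (deriv omega)).[x k] / (deriv omega).[x k] +
  derive1 v (x k) / v (x k).

Definition Y (v : R -> R) (t : R) : R :=
  v t * \sum_(k < n) (fund k).[t] ^+ 2 / v (x k).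

Definition interpolatory (L : 'I_n -> {poly R}) : Prop :=
  forall k i, (L k).[x i] = (k == i)%:R.

(* All [y k] are nonnegative, so the 0 in the maximum is harmless. *)
Definition stable (a b : \bar R) (v : R -> R) (L : 'I_n -> {poly R}) : Prop :=
  interpolatory L /\
  forall (y : 'I_n -> R), (forall k, 0 <= y k) ->
  forall t, opitv a b t ->
    0 <= v t * \sum_(k < n) (L k).[t] / v (x k) * y k <=
      \big[Num.max/0]_(k < n) y k.

(* The members of an interpolatory system are nonzero, so their degree is
   [(size _).-1]. *)
Definition total_degree (L : 'I_n -> {poly R}) : nat :=
  (\sum_(k < n) (size (L k)).-1)%N.

Definition most_economical (a b : \bar R) (v : R -> R)
    (L : 'I_n -> {poly R}) : Prop :=
  stable a b v L /\
  forall L', stable a b v L' -> (total_degree L <= total_degree L')%N.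

Definition fekete_functional (u : R -> R) (z : 'I_n -> R) : R :=
  (\prod_(i < n) \prod_(j < n | (i < j)%N) (`|z i - z j| * u (z i) * u (z j)))
    `^ (2 / (n * n.-1)%:R).

(* The supremum over [z] is attained at [x]. *)
Definition fekete_set (a b : \bar R) (u : R -> R) : Prop :=
  (forall k, opitv a b (x k)) /\
  forall z : 'I_n -> R, (forall k, opitv a b (z k)) ->
    fekete_functional u z <= fekete_functional u x.

(* [mrs] stands for the Mhaskar-Rakhmanov-Saff number of the weight. *)
Definition normal1 (a b : \bar R) (mrs : R) (v : R -> R) : Prop :=
  exists L : R, [/\ 1 < L,
    (forall k, `|x k| < L * mrs) &
    (forall t, opitv a b t -> Y v t <= 1)].

End Nodes.

Record orthonormal_polys (R : realType) (a b : \bar R) (w : R -> R)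
    (p : nat -> {poly R}) : Prop := OrthonormalPolys {
  orthonormal_size : forall m, size (p m) = m.+1 ;
  orthonormal_lead : forall m, 0 < lead_coef (p m) ;
  orthonormal_int : forall m k,
    \int[@lebesgue_measure R]_(t in opitv a b)
      ((p m).[t] * (p k).[t] * w t) = (m == k)%:R }.

Definition varrho (R : realType) (p : nat -> {poly R}) (n : nat) : R :=
  lead_coef (p n.-1) / lead_coef (p n).

(* The integrand is nonnegative when [Q] is convex. Should its integral be
   infinite, the value here is 0, and [w * varrho / An] is 0 as it is with
   [An = +oo]. *)
Definition An (R : realType) (a b : \bar R) (w Q : R -> R)
    (p : nat -> {poly R}) (n : nat) (t : R) : R :=
  varrho p n * \int[@lebesgue_measure R]_(s in opitv a b)
    ((p n).[s] ^+ 2 * w s * ((derive1 Q s - derive1 Q t) / (s - t))).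

Definition root_weight (R : realType) (n : nat) (v : R -> R) : R -> R :=
  fun t => v t `^ (2 * n.-1)%:R^-1.

(* Main.v *)
(** Both parts rest on the critical point equations (A): the logarithmic
    derivative of the weight [v] at [x k] is [- 2 \sum_(j != k) (x k - x j)^-1].
    Log-concavity makes every critical point a maximum of the Fekete functional,
    after reordering the competitor like [x]. The sum [Y / v] is the polynomial
    interpolating [1 / v] at the nodes, and also its derivative exactly when (A)
    holds, so the Hermite error formula and [(1 / v)^(2n) >= 0] give [Y <= 1];
    this is what (D) and (E) say, because the members of a stable system are
    nonnegative and hence have double zeros at the other nodes.

    For the zeros of the orthogonal polynomial [p n], write
    [w / wn (t) = \int p^2 w (Q'(s) - Q'(t)) / (s - t) ds]. As [Q'] is monotone,
    replacing [p^2] by the smaller [g^2 (s - t) (s - x k + d)], with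
    [g = p / (X - x k)] and [d = t - x k], bounds this integral from below by an
    expression that integration by parts and orthogonality evaluate; the two
    agree at [t = x k], hence so do their derivatives, and this is (A) for [wn].
    The converse follows from the uniqueness of solutions of (A): two solutions
    in the same order differ by a translation, along which [1 / v] would be both
    an exponential and a polynomial, so that all the sums in (A) would vanish. *)

From mathcomp Require Import fingroup perm.
Require Import Defs.
From mathcomp Require Import all_boot all_order all_algebra.
From mathcomp Require Import all_classical all_reals all_analysis.
From mathcomp Require Import measurable_realfun.
From mathcomp Require Import ring lra zify.
Import Order.TTheory GRing.Theory Num.Theory.
Import numFieldNormedType.Exports.
Local Open Scope classical_set_scope.
Local Open Scope ring_scope.

Set Implicit Arguments.
Unset Strict Implicit.
Unset Printing Implicit Defensive.

(** * Points and balls inside the interval *)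

Lemma opitv_le (R : realType) (a b : \bar R) (c d t : R) :
  opitv a b c -> opitv a b d -> c <= t -> t <= d -> opitv a b t.
Proof.
move=> [ac _] [_ db] ct td; split.
  by apply: lt_le_trans ac _; rewrite lee_fin.
by apply: le_lt_trans db; rewrite lee_fin.
Qed.

Lemma near_opitv (R : realType) (a b : \bar R) (t : R) :
  opitv a b t -> \forall s \near t, opitv a b s.
Proof. by move=> [at_ tb]; apply: (nbhs_interval at_ tb) => y ay yb; split. Qed.

Lemma opitv_ball (R : realType) (a b : \bar R) (t : R) : opitv a b t ->
  exists2 e : R, 0 < e & forall s, `|s - t| <= e -> opitv a b s.
Proof.
move=> /near_opitv /nbhs_ballP[e /= e0 He]; exists (e / 2); first by rewrite divr_gt0.
move=> s st; apply: He; rewrite /ball /= distrC (le_lt_trans st) //.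
by rewrite ltr_pdivrMr // ltr_pMr // ltr1n.
Qed.

(** * Rolle's theorem and the Hermite interpolation error *)

Section Calculus.
Variable R : realType.
Implicit Types (f g : R -> R) (t c d : R).

Lemma is_derive1M f g t c d : is_derive t 1 f c -> is_derive t 1 g d ->
  is_derive t 1 (fun s => f s * g s) (c * g t + f t * d).
Proof.
move=> hf hg; apply: (is_derive_eq (is_deriveM hf hg)).
by rewrite /GRing.scale /= addrC mulrC.
Qed.

Lemma is_derive1B f g t c d : is_derive t 1 f c -> is_derive t 1 g d ->
  is_derive t 1 (fun s => f s - g s) (c - d).
Proof. by move=> hf hg; exact: (is_deriveB hf hg). Qed.

Lemma is_derive1V f t c : f t != 0 -> is_derive t 1 f c ->
  is_derive t 1 (fun s => (f s)^-1) (- c / f t ^+ 2).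
Proof.
move=> f0 hf; apply: (is_derive_eq (is_deriveV f0 hf)).
by rewrite /GRing.scale /= mulNr mulrC mulNr.
Qed.

Lemma is_derive_continuous f t c : is_derive t 1 f c -> {for t, continuous f}.
Proof.
by move=> hf; apply/differentiable_continuous/derivable1_diffP; exact: ex_derive.
Qed.

Lemma is_derive1_unique f t c d :
  is_derive t 1 f c -> is_derive t 1 f d -> c = d.
Proof. by move=> [_ <-] [_ <-]. Qed.

Lemma derive1_is_derive f t : derivable f t 1 -> is_derive t 1 f (f^`()%classic t).
Proof. by move=> df; rewrite derive1E; exact: DeriveDef. Qed.

Variables a b : \bar R.

Lemma opitv_is_derive_within f c d (f' : R -> R) : opitv a b c -> opitv a b d ->
  (forall t, opitv a b t -> is_derive t 1 f (f' t)) ->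
  {within `[c, d], continuous f}.
Proof.
move=> hc hd hf; apply: derivable_within_continuous => t.
rewrite in_itv /= => /andP[ct td].
by have /= h := hf t (opitv_le hc hd ct td); exact: ex_derive.
Qed.

Lemma opitv_MVT f (f' : R -> R) c d : opitv a b c -> opitv a b d -> c < d ->
  (forall t, opitv a b t -> is_derive t 1 f (f' t)) ->
  exists e, [/\ c < e, e < d & f d - f c = f' e * (d - c)].
Proof.
move=> hc hd cd hf.
have [t| |e] := @MVT R f f' c d cd.
- rewrite in_itv /= => /andP[ct td]; exact: hf (opitv_le hc hd (ltW ct) (ltW td)).
- exact: opitv_is_derive_within hc hd hf.
- by rewrite in_itv /= => /andP[ce ed] E; exists e.
Qed.

Lemma local_max_derive f t c : opitv a b t -> is_derive t 1 f c ->
  (forall s, opitv a b s -> derivable f s 1) ->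
  (forall s, opitv a b s -> f s <= f t) -> c = 0.
Proof.
move=> ht ftc df max.
have [e e0 he] := opitv_ball ht.
apply: (is_derive1_unique ftc).
have te : t - e < t + e by rewrite ltrBlDr -addrA ltrDl addr_gt0.
have hs s : s \in `](t - e), (t + e)[ -> opitv a b s.
  by rewrite in_itv /= => /andP[h1 h2]; apply: he; rewrite ler_distl (ltW h1) ltW.
apply: (derive1_at_max (ltW te)) => [s /hs /df//||s /hs /max//].
by rewrite in_itv /= ltrBlDr !ltrDl e0.
Qed.

(** Each new zero lies strictly inside one gap of the list, hence off the list. The bound [u < t]
    serves the induction: it separates the later zeros from the one found in the first gap. *)
Lemma path_rolle f (f' : R -> R) (u : R) (s : seq R) :
  (forall t, opitv a b t -> is_derive t 1 f (f' t)) ->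
  path <%O u s -> (forall t, t \in u :: s -> opitv a b t /\ f t = 0) ->
  exists s' : seq R, [/\ size s' = size s, uniq s',
    forall t, t \in s' -> [/\ opitv a b t, f' t = 0 & t \notin u :: s] &
    forall t, t \in s' -> u < t].
Proof.
move=> hf; elim: s u => [|v s IH] u; first by exists [::].
rewrite [path _ _ _]/= => /andP[uv ps] hs.
have [|s' [sz us' hs' gt]] := IH _ ps.
  by move=> t ts; apply: hs; rewrite inE ts orbT.
have [hu fu] : opitv a b u /\ f u = 0 by apply: hs; rewrite inE eqxx.
have [hv fv] : opitv a b v /\ f v = 0 by apply: hs; rewrite !inE eqxx orbT.
have [e [ue ev E]] := opitv_MVT hu hv uv hf.
have f'e : f' e = 0.
  have : f' e * (v - u) = 0 by rewrite -E fu fv subr0.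
  by move/eqP; rewrite mulf_eq0 subr_eq0 (gt_eqF uv) orbF => /eqP.
have lev t : t \in v :: s -> v <= t.
  rewrite inE => /orP[/eqP->//|ts]; move: ps; rewrite lt_path_sortedE => /andP[/allP/(_ t ts)/ltW//].
exists (e :: s'); split => /=.
- by rewrite sz.
- rewrite us' andbT; apply/negP => /gt ve.
  by have := lt_trans ve ev; rewrite ltxx.
- move=> t; rewrite inE => /orP[/eqP->|ts'].
    split=> //; first exact: opitv_le hu hv (ltW ue) (ltW ev).
    rewrite inE (gt_eqF ue) /=; apply/negP => /lev.
    by rewrite leNgt ev.
  have [h1 h2 h3] := hs' _ ts'; split=> //.
  by rewrite inE negb_or h3 andbT gt_eqF // (lt_trans uv) // gt.
- move=> t; rewrite inE => /orP[/eqP->//|/gt]; exact: lt_trans.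
Qed.

Lemma uniq_rolle f (f' : R -> R) (s : seq R) :
  (forall t, opitv a b t -> is_derive t 1 f (f' t)) -> uniq s ->
  (forall t, t \in s -> opitv a b t /\ f t = 0) ->
  exists s' : seq R, [/\ size s' = (size s).-1, uniq s' &
    forall t, t \in s' -> [/\ opitv a b t, f' t = 0 & t \notin s]].
Proof.
move=> hf us hs.
have [r r_sorted [ss mm]] : exists2 r : seq R, sorted <%O r & size r = size s /\ r =i s.
  by exists (sort <=%O s); [rewrite sort_lt_sorted | rewrite size_sort; split=> // t; rewrite mem_sort].
case: r r_sorted ss mm => [|u r] /= pr ss mm; first by exists [::]; rewrite -ss.
have [|s' [sz us' hs' _]] := path_rolle hf pr.
  by move=> t; rewrite mm => /hs.
exists s'; rewrite -ss; split=> // t /hs' [? ?].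
by rewrite mm.
Qed.

(** Each pass of Rolle loses one zero. The derivatives form a family [G], so that the induction can
    shift it and [hermite_le] can start from the first derivative. *)
Lemma iter_rolle (G : nat -> R -> R) (m : nat) (s : seq R) :
  (forall k t, (k < m)%N -> opitv a b t -> is_derive t 1 (G k) (G k.+1 t)) ->
  uniq s -> (m < size s)%N ->
  (forall t, t \in s -> opitv a b t /\ G 0%N t = 0) ->
  exists2 t, opitv a b t & G m t = 0.
Proof.
elim: m G s => [|m IH] G s hG us ms hs.
  by case: s us ms hs => // u s _ _ /(_ u); rewrite inE eqxx => -[//|hu Gu]; exists u.
have [s' [sz us' hs']] := uniq_rolle (fun t => @hG 0%N t isT) us hs.
apply: (IH (fun k => G k.+1) s' _ us').
- by move=> k t km; apply: hG.
- by rewrite sz; lia.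
- by move=> t /hs'[].
Qed.

Lemma nderiv_is_derive m f k t : nderiv_ge0 a b m f -> (k < m)%N -> opitv a b t ->
  is_derive t 1 (derive1n k f) (derive1n k.+1 f t).
Proof.
by move=> hf km ht; rewrite derive1nS; apply: derive1_is_derive; have [/(_ k km)] := hf t ht.
Qed.

Lemma derivn_top (p : {poly R}) m : (size p <= m.+1)%N -> p^`(m) = (p`_m *+ m`!)%:P.
Proof.
move=> sp; apply/polyP => i; rewrite coef_derivn coefC.
case: eqP => [->|/eqP i0]; first by rewrite addn0 ffactnn.
by rewrite nth_default ?mul0rn //; apply: leq_trans sp _; lia.
Qed.

(* Rolle's theorem applied to [f - P - K omega^2], which vanishes at [t] and
   doubly at the nodes; its [2n]-th derivative is [f^(2n) - K (2n)!]. *)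
Lemma hermite_le n (x : 'I_n -> R) (P : {poly R}) f t :
  (0 < n)%N ->
  nderiv_ge0 a b (2 * n) f -> (forall k, opitv a b (x k)) -> injective x ->
  (size P <= 2 * n)%N ->
  (forall k, P.[x k] = f (x k)) ->
  (forall k, P^`().[x k] = f^`()%classic (x k)) ->
  opitv a b t -> P.[t] <= f t.
Proof.
move=> n0 hf hx injx sP Pf P'f' ht.
have om_mon : omega x \is monic by exact: monic_prod_XsubC.
have som : size (omega x) = n.+1.
  by rewrite /omega size_prod_XsubC /index_enum -enumT size_enum_ord.
have omx k : (omega x).[x k] = 0.
  by rewrite /omega horner_prod (bigD1 k) //= hornerXsubC subrr mul0r.
have [[k ->]|tx] := pselect (exists k, t = x k); first by rewrite Pf.
have omt : (omega x).[t] != 0.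
  rewrite /omega horner_prod; apply/prodf_neq0 => k _.
  by rewrite hornerXsubC subr_eq0; apply/eqP => E; apply: tx; exists k.
pose K := (f t - P.[t]) / (omega x).[t] ^+ 2.
pose q := P + K *: (omega x) ^+ 2.
pose G k s := derive1n k f s - (q^`(k)).[s].
have som2 : size (omega x ^+ 2) = (2 * n).+1.
  by rewrite expr2 size_monicM ?monic_neq0 // som; lia.
have om2_mon : omega x ^+ 2 \is monic by rewrite expr2 monicMl.
have sq : (size q <= (2 * n).+1)%N.
  rewrite (leq_trans (size_polyD _ _)) // geq_max (leq_trans sP) //=.
  by rewrite (leq_trans (size_scale_leq _ _)) // som2.
have hG k s : (k < 2 * n)%N -> opitv a b s -> is_derive s 1 (G k) (G k.+1 s).
  move=> kn hs; apply: is_derive1B; exact: nderiv_is_derive hf kn hs.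
pose xs := [seq x k | k <- enum 'I_n].
have uxs : uniq xs by rewrite map_inj_uniq ?enum_uniq.
(* Rolle on the [n + 1] zeros of [G 0] gives [n] zeros of [G 1] off the nodes. With the nodes, where
   [G 1] vanishes too, these are [2n] zeros, enough for [2n - 1] further derivatives. *)
have [s' [sz us' hs']] : exists s' : seq R, [/\ size s' = n, uniq s' &
    forall s, s \in s' -> [/\ opitv a b s, G 1%N s = 0 & s \notin t :: xs]].
  have [|||s' [sz us' hs']] := @uniq_rolle (G 0%N) (G 1%N) (t :: xs).
  - by move=> s; apply: hG; lia.
  - rewrite /= uxs andbT; apply/negP => /mapP[k _ tk]; by apply: tx; exists k.
  - move=> s; rewrite inE => /orP[/eqP->|/mapP[k _ ->]]; split=> //.
      rewrite /G derive1n0 derivn0 /q hornerD hornerZ horner_exp /K divfK ?expf_neq0 //; ring.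
    by rewrite /G derive1n0 derivn0 /q hornerD hornerZ horner_exp omx expr0n /= mulr0 addr0 Pf subrr.
  by exists s'; split=> //; rewrite sz /= size_map size_enum_ord.
have G1x k : G 1%N (x k) = 0.
  rewrite /G derivn1 /q derivD derivZ expr2 derivM hornerD hornerZ hornerD !hornerM omx.
  by rewrite mul0r mulr0 addr0 mulr0 addr0 P'f' subrr.
have [||||xi hxi] := @iter_rolle (fun k => G k.+1) (2 * n).-1 (s' ++ xs).
- by move=> k s kn; apply: hG; lia.
- rewrite cat_uniq us' uxs andbT /=; apply/hasPn => s sxs.
  by apply/negP => /hs'[_ _]; rewrite inE sxs orbT.
- by rewrite size_cat sz size_map size_enum_ord; lia.
- move=> s; rewrite mem_cat => /orP[/hs'[]//|/mapP[k _ ->]].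
  by split.
rewrite prednK ?muln_gt0 ?n0 // /G derivn_top // hornerC => /eqP; rewrite subr_eq0 => /eqP E.
have := (hf xi hxi).2; rewrite E /q coefD coefZ.
have -> : P`_(2 * n) = 0 by rewrite nth_default.
have -> : (omega x ^+ 2)`_(2 * n) = 1.
  by have /monicP := om2_mon; rewrite lead_coefE som2.
rewrite add0r mulr1 -mulr_natr pmulr_lge0 ?ltr0n ?fact_gt0 // /K.
by rewrite pmulr_lge0 ?subr_ge0 // invr_gt0 exprn_even_gt0.
Qed.

End Calculus.

(** * The node polynomial and Lagrange interpolation *)

Section Nodes.
Variables (R : realType) (n : nat) (x : 'I_n -> R).

Definition omega_but (k : 'I_n) : {poly R} := \prod_(j < n | j != k) ('X - (x j)%:P).

(** The force on node [k] from unit charges at the other nodes; it is also [l_k'(x_k)] and half of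
    [omega'' / omega'] at [x k]. *)
Definition inv_gaps (k : 'I_n) : R := \sum_(j < n | j != k) (x k - x j)^-1.

Lemma omega_butE k : omega x = ('X - (x k)%:P) * omega_but k.
Proof. by rewrite /omega (bigD1 k). Qed.

Lemma size_omega : size (omega x) = n.+1.
Proof. by rewrite /omega size_prod_XsubC /index_enum -enumT size_enum_ord. Qed.

Lemma size_omega_but k : size (omega_but k) = n.
Proof.
have := size_omega; rewrite (omega_butE k) size_monicM ?monicXsubC ?monic_neq0 //; last first.
  exact: monic_prod_XsubC.
by rewrite size_XsubC /= => -[].
Qed.

Lemma horner_omega_but_neq k t : (forall j, j != k -> t != x j) ->
  (omega_but k).[t] != 0.
Proof.
move=> h; rewrite /omega_but horner_prod; apply/prodf_neq0 => j jk.
by rewrite hornerXsubC subr_eq0 h.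
Qed.

Lemma horner_omega_but_eq0 k j : j != k -> (omega_but k).[x j] = 0.
Proof.
by move=> jk; rewrite /omega_but horner_prod (bigD1 j) //= hornerXsubC subrr mul0r.
Qed.

Lemma deriv_prod_XsubC (I : eqType) (r : seq I) (P : pred I) (y : I -> R) t :
  (forall j, P j -> t != y j) ->
  (\prod_(j <- r | P j) ('X - (y j)%:P))^`().[t] =
  (\prod_(j <- r | P j) ('X - (y j)%:P)).[t] * \sum_(j <- r | P j) (t - y j)^-1.
Proof.
move=> h; elim: r => [|j r IH].
  by rewrite !big_nil -[1]/(1%:P) derivC hornerC mulr0 horner0.
rewrite !big_cons; case: ifP => // Pj.
rewrite derivM hornerD !hornerM IH derivXsubC hornerC hornerXsubC mul1r.
have : t - y j != 0 by rewrite subr_eq0 h.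
by move=> nz; field.
Qed.

Hypothesis injx : injective x.

Lemma node_neq j k : j != k -> x k != x j.
Proof. by apply: contra => /eqP/injx->. Qed.

Lemma deriv_omega k : (omega x)^`().[x k] = (omega_but k).[x k].
Proof.
by rewrite (omega_butE k) derivM hornerD !hornerM derivXsubC hornerC hornerXsubC subrr mul0r addr0 mul1r.
Qed.

Lemma deriv_omega_neq0 k : (omega x)^`().[x k] != 0.
Proof.
by rewrite deriv_omega horner_omega_but_neq // => j; exact: node_neq.
Qed.

(** The division in [fund] is exact, because [omega x] contains the factor [X - x k]. *)
Lemma fundE k : fund x k = ((omega_but k).[x k])^-1 *: omega_but k.
Proof.
have nz := deriv_omega_neq0 k.
rewrite /fund deriv_omega divpZr ?[in omega x](omega_butE k) -?deriv_omega //.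
by rewrite mulrC mulpK // polyXsubC_eq0.
Qed.

Lemma fund_node k i : (fund x k).[x i] = (k == i)%:R.
Proof.
rewrite fundE hornerZ; have [<-|ki] := eqVneq k i.
  by rewrite mulVf // -deriv_omega deriv_omega_neq0.
by rewrite (horner_omega_but_eq0 (j := i)) ?mulr0 // eq_sym.
Qed.

Lemma size_fund k : size (fund x k) = n.
Proof.
by rewrite fundE size_scale ?size_omega_but // invr_eq0 -deriv_omega deriv_omega_neq0.
Qed.

Lemma deriv_fund k : (fund x k)^`().[x k] = inv_gaps k.
Proof.
rewrite fundE derivZ hornerZ deriv_prod_XsubC => [|j]; last exact: node_neq.
by rewrite mulKf // -deriv_omega deriv_omega_neq0.
Qed.

Lemma fejer_ratio k :
  (omega x)^`()^`().[x k] / (omega x)^`().[x k] = 2 * inv_gaps k.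
Proof.
rewrite -deriv_fund fundE derivZ hornerZ -deriv_omega.
have -> : (omega x)^`()^`().[x k] = 2 * (omega_but k)^`().[x k].
  rewrite (omega_butE k) derivM derivXsubC mul1r derivD derivM derivXsubC mul1r.
  by rewrite !hornerD hornerM hornerXsubC subrr; ring.
by rewrite -mulrA mulrC -mulrA mulrC mulrA (mulrC _^-1).
Qed.

Lemma fejer_constE v k :
  fejer_const x v k = 2 * inv_gaps k + v^`()%classic (x k) / v (x k).
Proof. by rewrite /fejer_const fejer_ratio. Qed.

(** The difference of the two sides has [n] distinct roots and size at most [n]. *)
Lemma lagrange (q : {poly R}) : (size q <= n)%N ->
  q = \sum_(k < n) q.[x k] *: fund x k.
Proof.
move=> sq; apply/eqP; rewrite -subr_eq0; apply/eqP.
set d := q - _.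
apply: (@roots_geq_poly_eq0 _ d [seq x k | k <- enum 'I_n]).
- apply/allP => _ /mapP[k _ ->]; rewrite /root /d hornerD hornerN horner_sum.
  rewrite (bigD1 k) //= hornerZ fund_node eqxx mulr1 big1 ?addr0 ?subrr //.
  by move=> i ik; rewrite hornerZ fund_node (negbTE ik) mulr0.
- by rewrite map_inj_uniq ?enum_uniq.
- rewrite size_map size_enum_ord (leq_trans (size_polyD _ _)) // geq_max sq size_polyN.
  apply: (leq_trans (size_sum _ _ _)); apply/bigmax_leqP => i _.
  by rewrite (leq_trans (size_scale_leq _ _)) // size_fund.
Qed.

End Nodes.

(** * Log-concave weights and the bound [Y <= 1] *)

Section Weight.
Variables (R : realType) (a b : \bar R) (v : R -> R).
Hypothesis hv : approximating a b v.

(** This is [- Q'] for a weight [exp (- Q)]. *)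
Definition logder (t : R) : R := v^`()%classic t / v t.

Lemma weight_neq0 t : opitv a b t -> v t != 0.
Proof. by move=> /(approximating_gt0 hv)/lt0r_neq0. Qed.

Lemma weight_is_derive t : opitv a b t -> is_derive t 1 v (v^`()%classic t).
Proof. by move=> /(approximating_derivable hv)[dv _]; exact: derive1_is_derive. Qed.

Lemma weight_is_derive_log t : opitv a b t ->
  is_derive t 1 (fun s => ln (v s)) (logder t).
Proof.
move=> ht; have v0 := approximating_gt0 hv ht.
apply: (is_derive_eq (is_derive1_comp (is_derive1_ln v0) (weight_is_derive ht))).
by rewrite mulrC.
Qed.

Lemma logder_derivable t : opitv a b t -> derivable logder t 1.
Proof.
move=> ht; have [_ d2] := approximating_derivable hv ht.
have h := is_derive1M (derive1_is_derive d2) (is_derive1V (weight_neq0 ht) (weight_is_derive ht)).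
exact: (@ex_derive _ _ _ _ _ _ _ h).
Qed.

Lemma logder_derivative_le0 t : opitv a b t -> logder^`()%classic t <= 0.
Proof.
move=> ht; have := approximating_logconcave hv ht.
rewrite derive1Sn derive1n1 => h.
rewrite -oppr_ge0; apply: le_trans h _.
rewrite !derive1E.
have -> : - 'D_1 logder t = 'D_1 (fun s => - logder s) t.
  by rewrite deriveN //; exact: logder_derivable.
rewrite le_eqVlt; apply/orP; left; apply/eqP; apply: near_eq_derive => //.
near=> s.
have hs : opitv a b s by near: s; exact: near_opitv.
have v0 := approximating_gt0 hv hs.
have : is_derive s 1 (fun u => ln (v u)^-1) (- logder s).
  apply: (@near_eq_is_derive _ _ _ (fun u => - ln (v u))).
    near=> u; rewrite lnV // posrE; apply: (approximating_gt0 hv).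
    by near: u; exact: near_opitv.
  by apply: is_deriveN; exact: weight_is_derive_log.
by move=> [_ <-]; rewrite derive1E.
Unshelve. all: by end_near. Qed.

Lemma logder_anti s t : opitv a b s -> opitv a b t -> s <= t -> logder t <= logder s.
Proof.
move=> hs ht; rewrite le_eqVlt => /orP[/eqP->//|st].
have [|e [se et E]] := @opitv_MVT R a b logder (logder^`()%classic) _ _ hs ht st.
  by move=> u hu; apply/derive1_is_derive/logder_derivable.
rewrite -subr_le0 E mulr_le0_ge0 ?subr_ge0 ?(ltW st) // logder_derivative_le0 //.
exact: opitv_le hs ht (ltW se) (ltW et).
Qed.

(** The concave function [ln v] lies below its tangent at [s]. This bound drives both the comparison
    of Fekete products and the decay of the weight at infinite ends. *)
Lemma weight_tangent s t : opitv a b s -> opitv a b t ->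
  v t <= v s * expR (logder s * (t - s)).
Proof.
move=> hs ht; have vs := approximating_gt0 hv hs; have vt := approximating_gt0 hv ht.
suff h : ln (v t) - ln (v s) <= logder s * (t - s).
  rewrite -[leLHS]lnK ?posrE // -{1}[v s]lnK ?posrE // -expRD ler_expR; lra.
have [st|ts|->] := ltgtP s t; last by rewrite !subrr mulr0.
- have [e [se et ->]] := opitv_MVT hs ht st weight_is_derive_log.
  rewrite ler_wpM2r ?subr_ge0 ?(ltW st) // logder_anti ?(ltW se) //.
  exact: opitv_le hs ht (ltW se) (ltW et).
- have [e [te es E]] := opitv_MVT ht hs ts weight_is_derive_log.
  have : logder s <= logder e.
    by rewrite logder_anti ?(ltW es) //; exact: opitv_le ht hs (ltW te) (ltW es).
  by nra.
Qed.

Lemma weight_is_deriveV t : opitv a b t ->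
  is_derive t 1 (fun s => (v s)^-1) (- logder t / v t).
Proof.
move=> ht; apply: (is_derive_eq (is_derive1V (weight_neq0 ht) (weight_is_derive ht))).
have v0 := weight_neq0 ht; rewrite /logder; by field.
Qed.

Variables (n : nat) (x : 'I_n -> R).
Hypotheses (hx : forall k, opitv a b (x k)) (injx : injective x) (n0 : (0 < n)%N).

Lemma fejer_const_eq0 k :
  (fejer_const x v k == 0) = (logder (x k) == - (2 * inv_gaps x k)).
Proof. by rewrite fejer_constE // -addr_eq0 addrC. Qed.

Definition hermite_interp : {poly R} := \sum_(k < n) (v (x k))^-1 *: (fund x k) ^+ 2.

Lemma YE t : Y x v t = v t * hermite_interp.[t].
Proof.
rewrite /Y /hermite_interp horner_sum; congr (_ * _).
by apply: eq_bigr => k _; rewrite hornerZ horner_exp mulrC.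
Qed.

Lemma size_hermite_interp : (size hermite_interp <= (2 * n).-1)%N.
Proof.
apply: (leq_trans (size_sum _ _ _)); apply/bigmax_leqP => k _.
rewrite (leq_trans (size_scale_leq _ _)) // (leq_trans (size_poly_exp_leq _ _)) // size_fund //.
lia.
Qed.

Lemma hermite_interp_node k : hermite_interp.[x k] = (v (x k))^-1.
Proof.
rewrite horner_sum (bigD1 k) //= hornerZ horner_exp fund_node // eqxx expr1n mulr1.
rewrite big1 ?addr0 // => i ik; rewrite hornerZ horner_exp fund_node // (negbTE ik).
by rewrite expr0n mulr0.
Qed.

Lemma deriv_hermite_interp_node k :
  hermite_interp^`().[x k] = 2 * inv_gaps x k / v (x k).
Proof.
rewrite raddf_sum horner_sum (bigD1 k) //= derivZ hornerZ expr2 derivM hornerD !hornerM.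
rewrite [X in _ + X]big1 => [|i ik]; first by rewrite fund_node // eqxx deriv_fund //= mulr1n; ring.
by rewrite derivZ hornerZ expr2 derivM hornerD !hornerM fund_node // (negbTE ik) mul0r !mulr0 addr0 mulr0.
Qed.

(** Under (A) [hermite_interp] is the Hermite interpolant of [1 / v], so [hermite_le] puts it below
    [1 / v]. Conversely [Y = 1] at the nodes, so the bound makes each node a maximum, and the
    derivative of [Y] there is the Fejer constant. *)
Lemma Y_le1P : nderiv_ge0 a b (2 * n) (fun t => (v t)^-1) ->
  (forall k, fejer_const x v k = 0) <-> (forall t, opitv a b t -> Y x v t <= 1).
Proof.
move=> hn; split=> [C0 t ht|Yle k].
  rewrite YE -ler_pdivlMl ?(approximating_gt0 hv) // mulr1.
  apply: (@hermite_le R a b n x hermite_interp (fun t => (v t)^-1)) => //.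
  - by rewrite (leq_trans size_hermite_interp) // leq_pred.
  - exact: hermite_interp_node.
  - move=> k; rewrite deriv_hermite_interp_node.
    rewrite derive1E; have [_ ->] := weight_is_deriveV (hx k).
    by have /eqP := C0 k; rewrite fejer_const_eq0 => /eqP->; rewrite opprK.
have dY t : opitv a b t -> is_derive t 1 (fun s => v s * hermite_interp.[s])
    (v^`()%classic t * hermite_interp.[t] + v t * hermite_interp^`().[t]).
  by move=> ht; apply: is_derive1M; exact: weight_is_derive.
have := @local_max_derive R a b _ _ _ (hx k) (dY _ (hx k)).
have v0 := weight_neq0 (hx k).
rewrite hermite_interp_node deriv_hermite_interp_node fejer_constE //.
have -> : v (x k) * (2 * inv_gaps x k / v (x k)) = 2 * inv_gaps x k by field.
rewrite addrC; apply.
  by move=> s hs; have h := dY s hs; exact: ex_derive.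
by move=> s hs; rewrite mulfV // -YE Yle.
Qed.

End Weight.

(** * Stability and minimal degrees *)

Section Economy.
Variables (R : realType) (a b : \bar R) (n : nat) (x : 'I_n -> R) (v : R -> R).
Hypotheses (v_gt0 : forall t, opitv a b t -> 0 < v t).
Hypotheses (hx : forall k, opitv a b (x k)) (injx : injective x) (n0 : (0 < n)%N).

Lemma omega_but_dvdp k (q : {poly R}) :
  (forall j, j != k -> q.[x j] = 0) -> omega_but x k %| q.
Proof.
move=> hq; pose r := [seq x j | j <- index_enum 'I_n & j != k].
have -> : omega_but x k = \prod_(z <- r) ('X - z%:P) by rewrite big_map big_filter.
apply: uniq_roots_dvdp; last first.
  by rewrite uniq_rootsE map_inj_uniq // filter_uniq // index_enum_uniq.
by apply/allP => _ /mapP[j + ->]; rewrite mem_filter => /andP[jk _]; apply/eqP/hq.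
Qed.

(** Taking for [y] the indicator of [k] isolates the member [L k]. *)
Lemma stable_ge0 L k t : stable x a b v L -> opitv a b t -> 0 <= (L k).[t].
Proof.
move=> [_ st] ht.
have [|+ _] := andP (st (fun j => (j == k)%:R) _ t ht); first by move=> j; exact: ler0n.
rewrite pmulr_rge0 ?v_gt0 // (bigD1 k) //= eqxx mulr1 big1 ?addr0 => [|j /negbTE->].
  by rewrite pmulr_lge0 // invr_gt0 v_gt0.
by rewrite mulr0.
Qed.

(** At every other node [L k] attains its minimum 0 and so has a double zero: [omega_but x k ^+ 2],
    of degree [2n - 2], divides it. *)
Lemma stable_size L k : stable x a b v L -> (2 * n <= (size (L k)).+1)%N.
Proof.
move=> st; have [int _] := st.
have L0 j : j != k -> (L k).[x j] = 0 by rewrite eq_sym int => /negbTE->.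
have dL0 j : j != k -> (L k)^`().[x j] = 0.
  move=> jk; apply/eqP; rewrite -oppr_eq0; apply/eqP.
  have dL (s : R) : is_derive s 1 (fun t => - (L k).[t]) (- (L k)^`().[s]).
    by apply: is_deriveN; exact: is_derive_poly.
  apply: (local_max_derive (hx j) (dL _)) => s hs.
    by have h := dL s; exact: ex_derive.
  by rewrite L0 // oppr0 oppr_le0; exact: stable_ge0.
have [q Lq] := dvdpP _ _ (omega_but_dvdp L0).
(* The derivative of [q * omega_but x k] at [x j] is [q.[x j]] times that of [omega_but x k], which
   is nonzero since [x j] is a simple root of [omega x]. *)
have q0 j : j != k -> q.[x j] = 0.
  move=> jk; have := dL0 j jk; rewrite Lq derivM hornerD !hornerM horner_omega_but_eq0 //.
  rewrite mulr0 add0r => /eqP; rewrite mulf_eq0 => /orP[/eqP//|/eqP d0].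
  have := deriv_omega_neq0 injx j; rewrite (omega_butE x k) derivM hornerD !hornerM.
  by rewrite horner_omega_but_eq0 // d0 !mulr0 addr0 eqxx.
have [q' qq] := dvdpP _ _ (omega_but_dvdp q0).
have Ln0 : L k != 0.
  by apply/eqP => E; have := int k k; rewrite E horner0 eqxx => /eqP; rewrite eq_sym oner_eq0.
have : omega_but x k ^+ 2 %| L k by rewrite Lq qq -mulrA -expr2 dvdp_mulIr.
move=> /(dvdp_leq Ln0); rewrite expr2 size_monicM ?monic_neq0 ?size_omega_but //.
- move=> h; rewrite -[(2 * n)%N]prednK ?ltnS; last by lia.
  by rewrite mul2n -addnn.
- exact: monic_prod_XsubC.
- exact: monic_prod_XsubC.
Qed.

Lemma size_fund2 k : (size (fund x k ^+ 2)).+1 = (2 * n)%N.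
Proof.
have f0 : fund x k != 0 by rewrite -size_poly_eq0 size_fund // -lt0n.
by rewrite expr2 size_mul // size_fund //; lia.
Qed.

(** For [y = 1] the stability bound reads [Y <= 1]. Conversely each square has exactly the least
    degree allowed by [stable_size], so minimality holds member by member. *)
Lemma most_economicalP : most_economical x a b v (fun k => fund x k ^+ 2) <->
  (forall t, opitv a b t -> Y x v t <= 1).
Proof.
split=> [[[_ st] _] t ht|Yle].
  have [_] := andP (st (fun=> 1) (fun=> ler01) t ht).
  under eq_bigr do rewrite mulr1 horner_exp.
  move=> /le_trans; apply; apply: bigmax_le => //.
have L2 : stable x a b v (fun k => fund x k ^+ 2).
  split=> [k i|y y0 t ht].
    by rewrite horner_exp fund_node // -natrX; case: eqP.
  have term0 k : 0 <= (fund x k ^+ 2).[t] / v (x k).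
    by rewrite divr_ge0 ?(ltW (v_gt0 _)) // horner_exp sqr_ge0.
  apply/andP; split.
    by rewrite mulr_ge0 ?(ltW (v_gt0 _)) // sumr_ge0 // => k _; rewrite mulr_ge0.
  set M := (X in _ <= X).
  have M0 : 0 <= M by rewrite /M; elim/big_ind: _ => // p q p0 q0; rewrite le_max p0.
  apply: (@le_trans _ _ (Y x v t * M)); last by rewrite ler_piMl // Yle.
  rewrite /Y -mulrA ler_wpM2l ?(ltW (v_gt0 _)) // mulr_suml ler_sum // => k _.
  by rewrite -horner_exp ler_wpM2l // /M; exact: (le_bigmax_cond 0 y).
split=> // L hL; apply: leq_sum => k _.
by have := stable_size k hL; have := size_fund2 k; lia.
Qed.

End Economy.

(** * Fekete products and rearrangement *)

Section Fekete.
Variables (R : realType) (n : nat).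
Implicit Types (x z d : 'I_n -> R).

Lemma exchange_neq (T : Type) (idx : T) (op : Monoid.com_law idx) (F : 'I_n -> 'I_n -> T) :
  \big[op/idx]_(i < n) \big[op/idx]_(j < n | j != i) F i j =
  \big[op/idx]_(i < n) \big[op/idx]_(j < n | j != i) F j i.
Proof.
rewrite (exchange_big_dep predT) //=; apply: eq_bigr => j _.
by apply: eq_bigl => i; rewrite eq_sym.
Qed.

(** The pairs [(i, j)] and [(j, i)] have opposite gaps. Symmetrising in this way turns (A) into a
    statement about pairs. *)
Lemma sum_inv_gaps x (d : 'I_n -> R) :
  2 * \sum_(i < n) d i * inv_gaps x i =
  \sum_(i < n) \sum_(j < n | j != i) (d i - d j) / (x i - x j).
Proof.
under [RHS]eq_bigr do under eq_bigr do rewrite mulrBl.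
under [RHS]eq_bigr do rewrite big_split sumrN /=.
rewrite big_split sumrN /= [X in _ - X]exchange_neq /= -sumrN -big_split mulr_sumr.
apply: eq_bigr => i _ /=; rewrite /inv_gaps -sumrN -big_split /= !mulr_sumr.
apply: eq_bigr => j _; rewrite -[x j - x i]opprB invrN; ring.
Qed.

Lemma big_neq_pairs (T : Type) (idx : T) (op : Monoid.com_law idx) (F : 'I_n -> 'I_n -> T) :
  (forall i j, F i j = F j i) ->
  \big[op/idx]_(i < n) \big[op/idx]_(j < n | j != i) F i j =
  op (\big[op/idx]_(i < n) \big[op/idx]_(j < n | (i < j)%N) F i j)
     (\big[op/idx]_(i < n) \big[op/idx]_(j < n | (i < j)%N) F i j).
Proof.
move=> symF; transitivity (op (\big[op/idx]_(i < n) \big[op/idx]_(j < n | (i < j)%N) F i j)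
     (\big[op/idx]_(i < n) \big[op/idx]_(j < n | (j < i)%N) F i j)).
  rewrite -big_split; apply: eq_bigr => i _.
  rewrite (bigID (fun j : 'I_n => (i < j)%N)) /=; congr (op _ _); apply: eq_bigl => j.
    by rewrite -(inj_eq val_inj) /=; case: ltngtP.
  by rewrite -(inj_eq val_inj) /=; case: ltngtP.
congr (op _ _); rewrite (exchange_big_dep predT) //=; apply: eq_bigr => j _.
by apply: eq_bigr => i _.
Qed.

(** A permutation maximising [\sum_i x i * z (s i)] has no inversion, since exchanging two
    oppositely ordered values would increase the sum. *)
Lemma co_sort x z : exists s : 'S_n, forall i j, x i < x j -> z (s i) <= z (s j).
Proof.
pose val (s : 'S_n) := \sum_(i < n) x i * z (s i).
pose s0 := [arg max_(s > (1%g : 'S_n)) val s]%O.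
have smax s : val s <= val s0.
  by rewrite /s0; case: arg_maxP => //= r _; apply.
exists s0 => i j xij; rewrite leNgt; apply/negP => zij.
have ij : j != i by apply: contraTneq xij => ->; rewrite ltxx.
have := smax (tperm i j * s0)%g.
rewrite /val (bigD1 i) // (bigD1 j) //= [leRHS](bigD1 i) // [X in _ <= _ + X](bigD1 j) //=.
rewrite !permM tpermL tpermR.
rewrite (eq_bigr (fun k => x k * z (s0 k))) => [|k /andP[ki kj]]; last first.
  by rewrite permM tpermD // eq_sym.
by rewrite !addrA lerD2r; nra.
Qed.

(** With gaps over ordered pairs, this is the square of the product in [fekete_functional] for
    [root_weight n v]: each node lies in [n - 1] pairs, and squaring yields the power [2(n - 1)]
    that undoes the root. *)
Definition fekete_prod (v : R -> R) z : R :=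
  \prod_(i < n) \prod_(j < n | j != i) `|z i - z j| * \prod_(i < n) v (z i).

Lemma fekete_prod_perm v z (s : 'S_n) : fekete_prod v (fun i => z (s i)) = fekete_prod v z.
Proof.
rewrite /fekete_prod; congr (_ * _); last by rewrite [RHS](reindex_inj (@perm_inj _ s)).
rewrite [RHS](reindex_inj (@perm_inj _ s)); apply: eq_bigr => i _.
rewrite [RHS](reindex_inj (@perm_inj _ s)); apply: eq_bigl => j.
by rewrite (inj_eq perm_inj).
Qed.

Hypothesis n2 : (2 <= n)%N.

Lemma prod_const_neq (T : comNzRingType) (c : T) (i : 'I_n) : \prod_(j < n | j != i) c = c ^+ n.-1.
Proof. by rewrite prodr_const cardC1 card_ord. Qed.

Lemma root_weight_exp (v : R -> R) t : 0 <= v t ->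
  root_weight n v t ^+ (2 * n.-1) = v t.
Proof.
move=> v0; rewrite /root_weight -powR_mulrn ?powR_ge0 // -powRrM mulVf ?powRr1 //.
by rewrite pnatr_eq0; lia.
Qed.

Lemma fekete_functional_prod (v : R -> R) z : (forall i, 0 <= v (z i)) ->
  (\prod_(i < n) \prod_(j < n | (i < j)%N)
    (`|z i - z j| * root_weight n v (z i) * root_weight n v (z j))) ^+ 2 =
  fekete_prod v z.
Proof.
move=> v0; rewrite expr2 -big_neq_pairs => [|i j]; last first.
  by rewrite distrC -!mulrA; congr (_ * _); rewrite mulrC.
have splitE i : \prod_(j < n | j != i)
    (`|z i - z j| * root_weight n v (z i) * root_weight n v (z j)) =
  \prod_(j < n | j != i) `|z i - z j| * root_weight n v (z i) ^+ n.-1 *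
  \prod_(j < n | j != i) root_weight n v (z j).
  by rewrite !big_split /= prod_const_neq.
rewrite (eq_bigr _ (fun i _ => splitE i)) !big_split /= /fekete_prod -mulrA; congr (_ * _).
rewrite [X in _ * X]exchange_neq -big_split; apply: eq_bigr => i _.
by rewrite prod_const_neq /= -exprD addnn -mul2n root_weight_exp.
Qed.

(** Squaring and the power [2 / (n(n - 1))] are strictly increasing on nonnegative reals, so both
    functionals have the same maximisers. *)
Lemma fekete_setP (a b : \bar R) (v : R -> R) x :
  (forall t, opitv a b t -> 0 < v t) -> (forall k, opitv a b (x k)) ->
  fekete_set x a b (root_weight n v) <->
  (forall z, (forall k, opitv a b (z k)) -> fekete_prod v z <= fekete_prod v x).
Proof.
move=> v0 hx.
pose G z := \prod_(i < n) \prod_(j < n | (i < j)%N)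
    (`|z i - z j| * root_weight n v (z i) * root_weight n v (z j)).
have G0 z : 0 <= G z.
  by do 2!apply: prodr_ge0 => ? _; rewrite !mulr_ge0 ?powR_ge0.
have e0 : 0 < 2 / (n * n.-1)%:R :> R by rewrite divr_gt0 // ltr0n; nia.
have FE z : (forall k, opitv a b (z k)) ->
    (fekete_functional (root_weight n v) z <= fekete_functional (root_weight n v) x) =
    (fekete_prod v z <= fekete_prod v x).
  move=> hz; rewrite -!fekete_functional_prod; try by move=> i; exact/ltW/v0.
  rewrite -/(G z) -/(G x) ler_sqr ?nnegrE // /fekete_functional -/(G z) -/(G x).
  have := @gt0_ltr_powR R _ e0 (G x) (G z).
  have := @ge0_ler_powR R _ (ltW e0) (G z) (G x).
  rewrite !nnegrE => /(_ (G0 _) (G0 _)) h1 /(_ (G0 _) (G0 _)) h2.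
  by case: (leP (G z)) h1 h2 => [_ h _|_ _ h]; [exact: h | apply/negbTE; rewrite -ltNge h].
split=> [[_ h] z hz|h]; first by have := h z hz; rewrite (FE z hz); exact: id.
split; first exact: hx.
by move=> z hz; rewrite (FE z hz); exact: h.
Qed.

End Fekete.

(** * Critical points and Fekete sets *)

Section FeketeCritical.
Variables (R : realType) (a b : \bar R) (n : nat) (v : R -> R) (x : 'I_n -> R).
Hypotheses (hv : approximating a b v) (n2 : (2 <= n)%N).
Hypotheses (hx : forall k, opitv a b (x k)) (injx : injective x).

Lemma prod_norm_omega_but k t :
  \prod_(j < n | j != k) `|t - x j| = `|(omega_but x k).[t]|.
Proof.
rewrite /omega_but horner_prod normr_prod; apply: eq_bigr => j _.
by rewrite hornerXsubC.
Qed.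

(** When only node [k] moves, the factors without it form a positive constant; each gap at [k]
    occurs twice, whence the square. *)
Lemma fekete_prod_update k : exists2 C : R, 0 < C &
  forall z : 'I_n -> R, (forall j, j != k -> z j = x j) ->
  fekete_prod v z = (omega_but x k).[z k] ^+ 2 * v (z k) * C.
Proof.
exists (\prod_(i < n | i != k) \prod_(j < n | (j != i) && (j != k)) `|x i - x j| *
   \prod_(i < n | i != k) v (x i)).
  rewrite mulr_gt0 ?prodr_gt0 // => i ik; last by rewrite (approximating_gt0 hv).
  rewrite prodr_gt0 // => j /andP[ji _].
  by rewrite normr_gt0 subr_eq0 (inj_eq injx) eq_sym.
move=> z zx; rewrite /fekete_prod (bigD1 k) //= [X in _ * X = _](bigD1 k) //=.
rewrite [X in _ * (_ * X) = _](eq_bigr (fun i => v (x i))) => [|i /zx->//].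
rewrite [X in X * _ * _ = _](eq_bigr (fun j => `|z k - x j|)) => [|i /zx->//].
rewrite [X in _ * X * _ = _](eq_bigr (fun i => `|z k - x i| *
    \prod_(j < n | (j != i) && (j != k)) `|x i - x j|)) => [|i ik]; last first.
  rewrite (bigD1 k) 1?eq_sym //= zx // distrC; congr (_ * _).
  by apply: eq_bigr => j /andP[_ jk]; rewrite zx.
rewrite big_split /= prod_norm_omega_but -[(omega_but x k).[z k] ^+ 2]real_normK ?num_real //.
by ring.
Qed.

(** A Fekete set is maximal in each node separately. The derivative of [omega_but ^+ 2 * v] at [x k]
    is its nonzero value there times the Fejer constant. *)
Lemma fekete_fejer0 : fekete_set x a b (root_weight n v) ->
  forall k, fejer_const x v k = 0.
Proof.
move=> /(fekete_setP n2 (approximating_gt0 hv) hx) xmax k.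
have [C C0 hC] := fekete_prod_update k.
have vn0 := weight_neq0 hv (hx k).
have bn0 := deriv_omega_neq0 injx k; rewrite deriv_omega in bn0.
have le t : opitv a b t ->
    (omega_but x k).[t] ^+ 2 * v t <= (omega_but x k).[x k] ^+ 2 * v (x k).
  move=> ht; pose z j := if j == k then t else x j.
  rewrite -(ler_pM2r C0) -(hC x) //; have zk : z k = t by rewrite /z eqxx.
  rewrite -[in leLHS]zk -hC => [|j jk]; last by rewrite /z (negbTE jk).
  by apply: xmax => j; rewrite /z; case: ifP.
have dF t : opitv a b t -> is_derive t 1 (fun s => (omega_but x k ^+ 2).[s] * v s)
    ((omega_but x k ^+ 2)^`().[t] * v t + (omega_but x k ^+ 2).[t] * v^`()%classic t).
  by move=> ht; exact: (is_derive1M (is_derive_poly _ _) (weight_is_derive hv ht)).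
have := local_max_derive (hx k) (dF _ (hx k)).
move=> /(_ (fun s hs => @ex_derive _ _ _ _ _ _ _ (dF s hs))) E.
have {}E : (omega_but x k ^+ 2)^`().[x k] * v (x k) +
    (omega_but x k ^+ 2).[x k] * v^`()%classic (x k) = 0.
  by apply: E => s hs; rewrite !horner_exp le.
rewrite fejer_constE //; apply: (mulfI (mulf_neq0 (expf_neq0 2 bn0) vn0)).
rewrite mulr0 -[RHS]E expr2 derivM hornerD !hornerM deriv_prod_XsubC; last first.
  by move=> j; exact: node_neq.
rewrite -/(inv_gaps x k) -/(omega_but x k); by field.
Qed.

(** After reordering the competitor like [x], each ratio [r] of corresponding gaps is nonnegative
    and at most [expR (r - 1)], while [v] lies below its tangent exponentials. *)
Lemma fejer0_fekete : (forall k, fejer_const x v k = 0) ->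
  fekete_set x a b (root_weight n v).
Proof.
move=> C0; apply/(fekete_setP n2 (approximating_gt0 hv) hx) => y hy.
have [s hs] := co_sort x y; rewrite -(fekete_prod_perm _ _ s).
set z := fun i => y (s i); have hz k : opitv a b (z k) by exact: hy.
have {}hs i j : x i < x j -> z i <= z j by exact: hs.
pose d i := z i - x i.
have xn0 i j : j != i -> x i - x j != 0 by move=> ji; rewrite subr_eq0 node_neq.
have gap i j : j != i -> `|z i - z j| <= expR ((d i - d j) / (x i - x j)) * `|x i - x j|.
  move=> ji; have -> : (d i - d j) / (x i - x j) = (z i - z j) / (x i - x j) - 1.
    by have := xn0 i j ji; rewrite /d => nz; field.
  set r := (z i - z j) / (x i - x j).
  have r0 : 0 <= r.
    have [xij|xji|xe] := ltgtP (x i) (x j).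
    - by rewrite /r -mulrNN -invrN !opprB divr_ge0 ?subr_ge0 ?(ltW xij) // hs.
    - by rewrite divr_ge0 ?subr_ge0 ?(ltW xji) // hs.
    - by have := xn0 i j ji; rewrite xe subrr eqxx.
  rewrite -[X in `|X|](divfK (xn0 i j ji)) -/r normrM ger0_norm // ler_wpM2r //.
  by have := expR_ge1Dx (r - 1); rewrite addrC subrK.
(* By (A) the total exponent from the gaps is opposite to the one from the tangent bounds, so the
   exponentials cancel. *)
have sumE : \sum_(i < n) \sum_(j < n | j != i) (d i - d j) / (x i - x j) =
    - \sum_(i < n) logder v (x i) * d i.
  rewrite -sum_inv_gaps mulr_sumr -sumrN; apply: eq_bigr => i _.
  by have /eqP := C0 i; rewrite fejer_const_eq0 // => /eqP->; ring.
have expS (I : finType) (P : pred I) (f : I -> R) :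
    expR (\sum_(i | P i) f i) = \prod_(i | P i) expR (f i).
  by elim/big_rec2: _ => [|i p q _ <-]; rewrite ?expR0 ?expRD.
apply: (@le_trans _ _ (\prod_(i < n) \prod_(j < n | j != i)
    (expR ((d i - d j) / (x i - x j)) * `|x i - x j|) *
    \prod_(i < n) (expR (logder v (x i) * d i) * v (x i)))).
  apply: ler_pM.
  - by apply: prodr_ge0 => i _; exact: prodr_ge0.
  - by apply: prodr_ge0 => i _; exact/ltW/(approximating_gt0 hv).
  - apply: ler_prod => i _; rewrite prodr_ge0 //=.
    by apply: ler_prod => j ji; rewrite normr_ge0 gap.
  - apply: ler_prod => i _; rewrite ltW ?(approximating_gt0 hv) //= mulrC.
    have := weight_tangent hv (hx i) (hz i); exact: id.
rewrite big_split /= (eq_bigr (fun i => expR (\sum_(j < n | j != i) (d i - d j) / (x i - x j)) *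
   \prod_(j < n | j != i) `|x i - x j|)) => [|i _]; last by rewrite big_split /= expS.
rewrite big_split /= -!expS sumE mulrACA -expRD addNr expR0 mul1r.
exact: lexx.
Qed.

End FeketeCritical.

(** * Uniqueness of critical configurations *)

Section Uniqueness.
Variables (R : realType) (a b : \bar R) (n : nat) (v : R -> R).
Implicit Types (x y z : 'I_n -> R).

Lemma poly_eq0_itv (q : {poly R}) (c d : R) : c < d ->
  (forall t, c < t -> t < d -> q.[t] = 0) -> q = 0.
Proof.
(* The denominator [k.+2] keeps every sample point strictly below [d]. *)
move=> cd hq; pose f (k : nat) := c + (d - c) / k.+2%:R.
have dc : 0 < d - c by rewrite subr_gt0.
apply: (@roots_geq_poly_eq0 _ q [seq f k | k <- iota 0 (size q)]).
- apply/allP => _ /mapP[k _ ->]; apply/eqP/hq; rewrite /f.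
    by rewrite ltrDl divr_gt0.
  by rewrite -ltrBrDl ltr_pdivrMr // ltr_pMr // ltr1n.
- rewrite map_inj_uniq ?iota_uniq // => k l /addrI/(mulfI (lt0r_neq0 dc))/invr_inj/eqP.
  by rewrite eqr_nat => /eqP[].
- by rewrite size_map size_iota.
Qed.

(* The weighted Cauchy-Schwarz deficit of the two matrices [l_k (y_i)] and
   [m_i (x_k)], which are mutually inverse by Lagrange interpolation. *)
Lemma Y_pair_eq1 x y : injective x -> injective y ->
  (forall k, 0 < v (x k)) -> (forall k, 0 < v (y k)) ->
  (forall i, Y x v (y i) <= 1) -> (forall k, Y y v (x k) <= 1) ->
  forall i, Y x v (y i) = 1.
Proof.
move=> injx injy vx vy Yx Yy.
pose A i k := (fund x k).[y i]; pose B i k := (fund y i).[x k].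
have AB i : \sum_(k < n) A i k * B i k = 1.
  have -> : 1 = (fund y i).[y i] by rewrite fund_node // eqxx.
  rewrite {1}(lagrange injx (q := fund y i)) ?size_fund // horner_sum.
  by apply: eq_bigr => k _; rewrite hornerZ mulrC.
(* The left side is nonnegative and every summand on the right is at most 0, so all of them
   vanish. *)
have E : \sum_(i < n) \sum_(k < n) v (y i) / v (x k) *
      (A i k - B i k * v (x k) / v (y i)) ^+ 2 =
    \sum_(i < n) (Y x v (y i) - 1) + \sum_(k < n) (Y y v (x k) - 1).
  transitivity (\sum_(i < n) \sum_(k < n) (v (y i) * (A i k ^+ 2 / v (x k)) -
      2 * (A i k * B i k) + v (x k) * (B i k ^+ 2 / v (y i)))).
    apply: eq_bigr => i _; apply: eq_bigr => k _.
    by have := lt0r_neq0 (vx k); have := lt0r_neq0 (vy i) => h1 h2; field; rewrite h1 h2.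
  under eq_bigr do rewrite big_split sumrB /= -!mulr_sumr AB mulr1.
  rewrite big_split /= [X in _ + X = _]exchange_big /=.
  rewrite (eq_bigr (fun k => Y y v (x k)) (fun k _ => esym (mulr_sumr _ _ _ _))).
  rewrite !sumrB /= !sumr_const card_ord /Y -mulr_natr; ring.
have {}E : \sum_(i < n) (1 - Y x v (y i)) = 0.
  apply/eqP; rewrite eq_le; apply/andP; split; last first.
    by apply: sumr_ge0 => i _; rewrite subr_ge0.
  have h1 : \sum_(k < n) (Y y v (x k) - 1) <= 0.
    by apply: sumr_le0 => k _; rewrite subr_le0.
  have -> : \sum_(i < n) (1 - Y x v (y i)) = - \sum_(i < n) (Y x v (y i) - 1).
    by rewrite -sumrN; apply: eq_bigr => i _; rewrite opprB.
  rewrite oppr_le0; apply: (@le_trans _ _ (\sum_(i < n) (Y x v (y i) - 1) + \sum_(k < n) (Y y v (x k) - 1))).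
    rewrite -E; do 2!apply: sumr_ge0 => ? _.
    by rewrite mulr_ge0 ?sqr_ge0 // divr_ge0 // ltW.
  by rewrite gerDl.
move=> i; apply/esym/eqP; rewrite -subr_eq0; apply/eqP.
by apply: (psumr_eq0P _ E) => // k _; rewrite subr_ge0.
Qed.

Hypotheses (hv : approximating a b v) (n2 : (2 <= n)%N).
Hypothesis (hn : nderiv_ge0 a b (2 * n) (fun t => (v t)^-1)).

Let critical x := forall k, logder v (x k) = - (2 * inv_gaps x k).

Lemma critical_fejer x : injective x ->
  (forall k, fejer_const x v k = 0) <-> critical x.
Proof.
move=> injx; split=> h k.
  by apply/eqP; rewrite -fejer_const_eq0 // h.
by apply/eqP; rewrite fejer_const_eq0 // h.
Qed.

Lemma critical_Y x : injective x -> (forall k, opitv a b (x k)) -> critical x ->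
  forall t, opitv a b t -> Y x v t <= 1.
Proof.
move=> injx hx /(critical_fejer injx)/(Y_le1P hv hx injx); apply=> //.
exact: ltn_trans n2.
Qed.

(** For [d = x] in [sum_inv_gaps] every ordered pair contributes 1, so [\sum_i x i * inv_gaps x i]
    is [n(n - 1) / 2]. *)
Lemma inv_gaps_not0 x : injective x -> ~ forall i, inv_gaps x i = 0.
Proof.
move=> injx x0; have := sum_inv_gaps x x.
rewrite big1 ?mulr0 => [|i _]; last by rewrite x0 mulr0.
rewrite (eq_bigr (fun=> n.-1%:R)) => [|i _]; last first.
  rewrite (eq_bigr (fun=> 1)) => [|j ji]; last by rewrite divff // subr_eq0 node_neq.
  by rewrite sumr_const cardC1 card_ord.
rewrite sumr_const card_ord -mulrnA => /esym/eqP; rewrite pnatr_eq0.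
by nia.
Qed.

(* If a translate of a critical configuration is critical too, then so are the
   translates in between, all these configurations satisfy [Y = 1] at each
   other's nodes, and [1 / v] is there both a polynomial and an exponential. *)
Lemma critical_translate x (c : R) : injective x -> 0 < c ->
  (forall k, opitv a b (x k)) -> (forall k, opitv a b (x k + c)) ->
  critical x -> (forall k, logder v (x k + c) = logder v (x k)) -> False.
Proof.
move=> injx c0 hx hxc crx eqs; apply: (@inv_gaps_not0 x injx) => i.
have hy k u : 0 <= u -> u <= c -> opitv a b (x k + u).
  move=> u0 uc; apply: opitv_le (hx k) (hxc k) _ _; first by rewrite lerDl.
  by rewrite lerD2l.
(* [logder v] is antitone and takes the same value at both ends of [[x k, x k + c]], hence is
   constant in between. *)
have ys k u : 0 <= u -> u <= c -> logder v (x k + u) = logder v (x k).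
  move=> u0 uc; apply/eqP; rewrite eq_le; apply/andP; split.
    by apply: (logder_anti hv); rewrite ?lerDl //; exact: hy.
  by rewrite -eqs; apply: (logder_anti hv); rewrite ?lerD2l //; exact: hy.
pose H := hermite_interp v x.
have HV u : 0 <= u -> u <= c -> H.[x i + u] = (v (x i + u))^-1.
  move=> u0 uc; pose y k := x k + u.
  have injy : injective y by move=> k l /addIr/injx.
  have hyk k : opitv a b (y k) by exact: hy.
  have cry : critical y.
    move=> k; rewrite /y ys // crx; congr (- (2 * _)); apply: eq_bigr => j _.
    by congr (_^-1); rewrite /y; ring.
  have := @Y_pair_eq1 x y injx injy _ _ _ _ i.
  rewrite YE -/H => E; have vn0 := weight_neq0 hv (hyk i).
  apply: (mulfI vn0); rewrite mulfV // E // => k; try exact: (approximating_gt0 hv).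
    exact: critical_Y.
  exact: critical_Y.
(* On [(x i, x i + c)] the polynomial [H] equals [1 / v], whose logarithmic derivative is the
   constant [- logder v (x i)]. *)
have Hode : H^`() + logder v (x i) *: H = 0.
  apply: (@poly_eq0_itv _ (x i) (x i + c)); first by rewrite ltrDl.
  move=> t xt tc; have ut : 0 < t - x i by rewrite subr_gt0.
  have uc : t - x i < c by rewrite ltrBlDl.
  have tE : x i + (t - x i) = t by rewrite addrC subrK.
  have ht : opitv a b t by rewrite -tE; apply: hy; exact: ltW.
  have dV := weight_is_deriveV hv ht.
  have dH : is_derive t 1 (fun s => (v s)^-1) H^`().[t].
    apply: (@near_eq_is_derive _ _ _ (horner H)).
    near=> s; have s1 : x i < s by near: s; exact: lt_nbhsr.
    have s2 : s < x i + c by near: s; exact: lt_nbhsl.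
    have sE : x i + (s - x i) = s by rewrite addrC subrK.
    rewrite -sE HV ?subr_ge0 ?(ltW s1) //.
    by rewrite lerBlDl ltW.
  have HVt := HV _ (ltW ut) (ltW uc); rewrite tE in HVt.
  rewrite hornerD hornerZ (is_derive1_unique dH dV) HVt -(ys i _ (ltW ut) (ltW uc)) tE.
  by rewrite mulNr addNr.
have H0 : H != 0.
  apply/eqP => E; have := HV 0 (lexx _) (ltW c0); rewrite E horner0 => /esym/eqP.
  by rewrite invr_eq0 (negbTE (weight_neq0 hv (hy i 0 (lexx _) (ltW c0)))).
(* The derivative of a nonzero polynomial has smaller size, so the equation [Hode] forces the slope
   to vanish, and by criticality [inv_gaps x i] too. *)
have s0 : logder v (x i) = 0.
  apply/eqP/contraT => sn0; have := lt_size_deriv H0.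
  have -> : H^`() = - (logder v (x i) *: H) by apply/eqP; rewrite -addr_eq0 Hode.
  by rewrite size_polyN size_scale // ltnn.
have := crx i; rewrite s0 => /esym/eqP.
by rewrite oppr_eq0 mulf_eq0 pnatr_eq0 /= => /eqP.
Unshelve. all: by end_near. Qed.

(** The difference of the two systems is tested against [d = z - x]. The result is at most 0 because
    [logder v] is antitone; symmetrised, it is a sum of [(d i - d j)^2] over products of equally
    signed gaps, hence nonnegative. So every term vanishes. *)
Lemma critical_gap x z : injective x -> injective z ->
  (forall k, opitv a b (x k)) -> (forall k, opitv a b (z k)) ->
  (forall i j, x i < x j -> z i <= z j) -> critical x -> critical z ->
  (forall i j, z i - x i = z j - x j) /\
  (forall i, (z i - x i) * (logder v (z i) - logder v (x i)) = 0).
Proof.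
move=> injx injz hx hz xz crx crz; pose d i := z i - x i.
have dsx i : d i * (logder v (z i) - logder v (x i)) <= 0.
  rewrite /d; have [le|/ltW le] := leP (x i) (z i).
    by rewrite mulr_ge0_le0 ?subr_ge0 // subr_le0 (logder_anti hv).
  by rewrite mulr_le0_ge0 ?subr_le0 // subr_ge0 (logder_anti hv).
have xn0 i j : j != i -> x i - x j != 0 by move=> ji; rewrite subr_eq0 node_neq.
have zn0 i j : j != i -> z i - z j != 0 by move=> ji; rewrite subr_eq0 node_neq.
have gap i j : j != i -> 0 < (z i - z j) * (x i - x j).
  move=> ji; have := zn0 i j ji; have := xn0 i j ji.
  have [xij|xji|->] := ltgtP (x i) (x j); last by rewrite subrr eqxx.
    move=> _ zn; have zij : z i < z j by rewrite lt_neqAle xz // andbT -subr_eq0.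
    by rewrite nmulr_rgt0 subr_lt0.
  move=> _ zn; have zij : z j < z i by rewrite lt_neqAle xz // andbT eq_sym -subr_eq0.
  by rewrite mulr_gt0 // subr_gt0.
pose S i j := (d i - d j) ^+ 2 / ((z i - z j) * (x i - x j)).
have S0 i j : j != i -> 0 <= S i j.
  by move=> ji; rewrite /S divr_ge0 ?sqr_ge0 // ltW // gap.
have sumE : \sum_(i < n) d i * (logder v (z i) - logder v (x i)) =
    \sum_(i < n) \sum_(j < n | j != i) S i j.
  transitivity (2 * \sum_(i < n) d i * inv_gaps x i - 2 * \sum_(i < n) d i * inv_gaps z i).
    rewrite !mulr_sumr -sumrB; apply: eq_bigr => i _; rewrite crx crz; ring.
  rewrite !sum_inv_gaps -sumrB; apply: eq_bigr => i _; rewrite -sumrB.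
  apply: eq_bigr => j ji; rewrite /S /d.
  have := xn0 i j ji; have := zn0 i j ji => h1 h2; field; rewrite h1 h2 //.
have SS0 i : 0 <= \sum_(j < n | j != i) S i j by apply: sumr_ge0 => j; exact: S0.
have tot0 : \sum_(i < n) \sum_(j < n | j != i) S i j = 0.
  apply/eqP; rewrite eq_le sumr_ge0 // -sumE andbT.
  by apply: sumr_le0.
split=> [i j|i].
  have [->//|ji] := eqVneq j i.
  have Si0 : \sum_(j < n | j != i) S i j = 0 by apply: (psumr_eq0P _ tot0).
  have /eqP : S i j = 0 by apply: (psumr_eq0P _ Si0) => // k; exact: S0.
  rewrite /S mulf_eq0 invr_eq0 (gt_eqF (gap i j ji)) orbF sqrf_eq0 subr_eq0.
  by move/eqP.
have neg0 : \sum_(i < n) - (d i * (logder v (z i) - logder v (x i))) = 0.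
  by rewrite sumrN sumE tot0 oppr0.
have /eqP : - (d i * (logder v (z i) - logder v (x i))) = 0.
  by apply: (psumr_eq0P _ neg0) => // k _; rewrite oppr_ge0.
by rewrite oppr_eq0 => /eqP.
Qed.

(** With [z] relabelled in the order of [x], [critical_gap] makes it a translate of [x] with the
    same slopes, and [critical_translate] excludes a nonzero shift. *)
Lemma fejer0_unique x z : injective x -> injective z ->
  (forall k, opitv a b (x k)) -> (forall k, opitv a b (z k)) ->
  (forall k, fejer_const x v k = 0) -> (forall k, fejer_const z v k = 0) ->
  exists s : 'S_n, forall i, x i = z (s i).
Proof.
move=> injx injz hx hz /(critical_fejer injx) crx /(critical_fejer injz) crz.
have [s xz] := co_sort x z; exists s; pose y i := z (s i).
have injy : injective y by move=> i j /injz/perm_inj.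
have hy k : opitv a b (y k) by exact: hz.
have cry : critical y.
  move=> k; rewrite /y crz; congr (- (2 * _)); rewrite /inv_gaps.
  rewrite (reindex_inj (@perm_inj _ s)); apply: eq_bigl => j.
  by rewrite (inj_eq perm_inj).
have [dE sE] := critical_gap injx injy hx hy xz crx cry.
move=> i; apply/eqP; rewrite eq_sym -subr_eq0 -/(y i); apply/contraT => ne.
set c := y i - x i in ne.
have yE k : y k = x k + c by rewrite /c (dE i k) addrC subrK.
have eqs k : logder v (y k) = logder v (x k).
  have /eqP := sE k; rewrite (dE k i) mulf_eq0 (negbTE ne) subr_eq0 /=.
  by move/eqP.
have [cn|cp|ce] := ltgtP c 0; last by rewrite ce eqxx in ne.
(* [critical_translate] moves upwards, so a negative shift is read from [y] back to [x]. *)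
- exfalso; apply: (@critical_translate y (- c)) => // [|k|k]; first by rewrite oppr_gt0.
    by rewrite yE addrK.
  by rewrite yE addrK -yE eqs.
- exfalso; apply: (@critical_translate x c) => // k; first by rewrite -yE.
  by rewrite -yE eqs.
Qed.

End Uniqueness.

(** * Behaviour of the weight at the ends of the interval *)

Section Ends.
Variables (R : realType) (a b : \bar R) (w : R -> R).
Hypothesis hw : approximating a b w.

(** Termwise [(s |u|)^(i+1) <= (i+1)! exp (s |u|)]. The spare factor [|u|] yields decay and not just
    boundedness. *)
Lemma poly_exp_bound (q : {poly R}) (s : R) : 0 < s ->
  exists2 C : R, 0 <= C & forall u, `|q.[u]| * expR (- (s * `|u|)) * `|u| <= C.
Proof.
move=> s0; exists (\sum_(i < size q) `|q`_i| * (i.+1`!%:R / s ^+ i.+1)).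
  apply: sumr_ge0 => i _; rewrite mulr_ge0 // divr_ge0 // exprn_ge0 //; exact: ltW.
move=> u; rewrite horner_coef.
apply: (@le_trans _ _ ((\sum_(i < size q) `|q`_i| * `|u| ^+ i) * expR (- (s * `|u|)) * `|u|)).
  rewrite ler_wpM2r // ler_wpM2r ?expR_ge0 // (le_trans (ler_norm_sum _ _ _)) //.
  by apply: ler_sum => i _; rewrite normrM normrX.
rewrite !mulr_suml; apply: ler_sum => i _; rewrite -!mulrA ler_wpM2l //.
rewrite mulrCA -exprSr expRN mulrC ler_pdivrMr ?expR_gt0 //.
have := expR_ge1Dxn i (mulr_ge0 (ltW s0) (normr_ge0 u)).
rewrite exprMn => h; have si : 0 < s ^+ i.+1 by rewrite exprn_gt0.
have fi : 0 < (i.+1)`!%:R :> R by rewrite ltr0n fact_gt0.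
rewrite mulrAC ler_pdivlMr // mulrC -ler_pdivrMl // mulrC.
by apply: (le_trans _ h); rewrite [leLHS]mulrC (mulrC (`|u| ^+ _)) lerDr.
Qed.

(** The tangent at [c] bounds [w] by a decaying exponential of [|u k - c|]. Against a polynomial
    this leaves a multiple of [1 / |u k - c|], at most the harmonic sequence. *)
Lemma weight_seq_decay (q : {poly R}) (c s : R) (u : nat -> R) : 0 < s ->
  opitv a b c -> (forall k, opitv a b (u k)) ->
  (forall k, logder w c * (u k - c) <= - (s * `|u k - c|)) ->
  (forall k, k.+1%:R <= `|u k - c|) ->
  (q.[u k] * w (u k)) @[k --> \oo] --> (0 : R).
Proof.
move=> s0 hc hu hs hk.
have [C C0 hC] := poly_exp_bound (q \Po ('X + c%:P)) s0.
apply/norm_cvg0P.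
have H : \forall k \near \oo, (fun=> 0) k <= `|q.[u k] * w (u k)| <= w c * C * harmonic k.
  near=> k; rewrite normr_ge0 /=.
  have vc := approximating_gt0 hw hc; have vu := approximating_gt0 hw (hu k).
  have d0 : 0 < `|u k - c| by apply: lt_le_trans (hk k).
  have qE : q.[u k] = (q \Po ('X + c%:P)).[u k - c].
    by rewrite horner_comp hornerD hornerX hornerC subrK.
  have wle : w (u k) <= w c * expR (- (s * `|u k - c|)).
    by apply: le_trans (weight_tangent hw hc (hu k)) _; rewrite ler_pM2l // ler_expR.
  rewrite normrM (gtr0_norm vu).
  apply: (@le_trans _ _ (w c * (`|q.[u k]| * expR (- (s * `|u k - c|))))).
    by rewrite mulrCA ler_wpM2l.
  rewrite -[leRHS]mulrA ler_pM2l // qE.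
  apply: (@le_trans _ _ (C / `|u k - c|)); first by rewrite ler_pdivlMr.
  by rewrite ler_wpM2l // lef_pV2 ?posrE.
apply: (squeeze_cvgr H).
- exact: cvg_cst.
- rewrite -[X in _ --> X](mulr0 (w c * C)); apply: cvgMl_tmp; exact: cvg_harmonic.
Unshelve. all: by end_near. Qed.

(** The [al k] will be lower limits of truncated integrals whose boundary terms vanish. At a finite
    end this is the condition [w / (t - a) -> 0]; at [-oo] it comes from a tangent of positive
    slope. *)
Lemma left_end (c : R) : opitv a b c -> exists al : nat -> R,
  [/\ forall k, opitv a b (al k), forall k, al k < c,
      forall t, opitv a b t -> \forall k \near \oo, al k <= t &
      forall q : {poly R}, (q.[al k] * w (al k)) @[k --> \oo] --> (0 : R)].
Proof.
move=> hc; have : (a < +oo)%E by case: hc => ac _; exact: lt_trans ac (ltry _).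
case aE : a => [r| |] // _.
- have rc : r < c by case: (hc); rewrite aE lte_fin.
  pose al k := r + (c - r) / 2 * harmonic k.
  have al_gt k : r < al k by rewrite ltrDl mulr_gt0 ?divr_gt0 ?subr_gt0 ?invr_gt0.
  have al_lt k : al k < c.
    rewrite -ltrBrDl; apply: (@le_lt_trans _ _ ((c - r) / 2)); last by lra.
    by rewrite ler_piMr ?divr_ge0 ?subr_ge0 ?(ltW rc) // invf_le1 ?ler1n.
  have hal k : opitv a b (al k).
    rewrite aE; split; first by rewrite lte_fin.
    by case: hc => _; apply: lt_trans; rewrite lte_fin.
  have al_cvg : al k @[k --> \oo] --> r.
    rewrite -[X in _ --> X]addr0; apply: cvgD; first exact: cvg_cst.
    by rewrite -[X in _ --> X](mulr0 ((c - r) / 2)); apply: cvgMl_tmp; exact: cvg_harmonic.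
  have al_right : al k @[k --> \oo] --> r^'+.
    move=> P hP; have h : \forall y \near r, r < y -> P y by exact: hP.
    have [N _ HN] := al_cvg _ h; exists N => // k /HN hk; exact: hk (al_gt k).
  exists al; split=> // [k|t [rt _]|q]; first by rewrite -aE.
    by move: rt; rewrite lte_fin => rt; near=> k; apply: ltW; near: k; exact: cvgr_lt al_cvg _ rt.
  have h0 : w (al k) / (al k - r) @[k --> \oo] --> (0 : R).
    exact: (cvg_comp _ _ al_right (approximating_left hw aE)).
  have h1 : (q.[al k] * ((w (al k) / (al k - r)) * (al k - r))) @[k --> \oo] --> q.[r] * (0 * (r - r)).
    apply: cvgM; last by apply: cvgM => //; apply: cvgB al_cvg (cvg_cst _).
    by apply: continuous_cvg al_cvg; exact: continuous_horner.
  rewrite mul0r mulr0 in h1; apply: cvg_trans h1; apply: near_eq_cvg.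
  near=> k; rewrite divfK // subr_eq0 gt_eqF //.
- have [M hM] := admissible_decay (approximating_admissible hw) (approximating_gt0 hw hc).
  (* If the slope at this [t] were not positive, the tangent bound would give [w c <= w t]. But [t]
     lies beyond [M], so [|t| * w t < w c], and [|t| >= 1]. *)
  pose t := Order.min (Order.min (- M - 1) (- 1)) (c - 1).
  have tc : t < c by rewrite /t gt_min; apply/orP; right; lra.
  have tM : t <= - M - 1 by rewrite /t !ge_min lexx.
  have t1 : t <= - 1 by rewrite /t !ge_min lexx orbT.
  have low u : u <= c -> opitv a b u.
    move=> uc; rewrite aE; split; first exact: ltNyr.
    by case: hc => _; apply: le_lt_trans; rewrite lee_fin.
  have ht := low t (ltW tc).
  have s0 : 0 < logder w t.
    rewrite ltNge; apply/negP => s0.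
    have := hM t (subset_closure ht).
    have tn : `|t| = - t by rewrite ler0_norm //; lra.
    have wt := approximating_gt0 hw ht.
    rewrite tn => h; have {}h : - t * w t < w c by apply: h; lra.
    have : w c <= w t.
      apply: le_trans (weight_tangent hw ht hc) _.
      by rewrite ler_piMr ?(ltW wt) // expR_le1 mulr_le0_ge0 // subr_ge0 ltW.
    by nra.
  pose al (k : nat) := t - k.+1%:R.
  have alt k : al k < t by rewrite /al ltrBlDr ltrDl.
  have hal k : opitv a b (al k) by apply: low; exact/ltW/(lt_trans (alt k)).
  have aln k : `|al k - t| = k.+1%:R.
    by rewrite /al addrAC subrr add0r normrN normr_nat.
  exists al; split; rewrite -?aE //.
  + by move=> k; exact: lt_trans (alt k) tc.
  + move=> u _; near=> k; rewrite /al lerBlDl -lerBlDr.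
    by apply: (@le_trans _ _ k%:R); [near: k; exact: nbhs_infty_ger|rewrite ler_nat].
  + move=> q; apply: (@weight_seq_decay q t (logder w t)) => // k; last by rewrite aln.
    by rewrite aln /al addrAC subrr add0r mulrN.
Unshelve. all: by end_near. Qed.

(** The mirror image of [left_end], with a tangent of negative slope at [+oo]. *)
Lemma right_end (c : R) : opitv a b c -> exists be : nat -> R,
  [/\ forall k, opitv a b (be k), forall k, c < be k,
      forall t, opitv a b t -> \forall k \near \oo, t <= be k &
      forall q : {poly R}, (q.[be k] * w (be k)) @[k --> \oo] --> (0 : R)].
Proof.
move=> hc; have : (-oo < b)%E by case: hc => _ cb; exact: lt_trans (ltNyr _) cb.
case bE : b => [r| |] // _.
- have rc : c < r by case: (hc) => _; rewrite bE lte_fin.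
  pose be k := r - (r - c) / 2 * harmonic k.
  have be_lt k : be k < r by rewrite ltrBlDr ltrDl mulr_gt0 ?divr_gt0 ?subr_gt0 ?invr_gt0.
  have be_gt k : c < be k.
    rewrite ltrBrDr -ltrBrDl; apply: (@le_lt_trans _ _ ((r - c) / 2)); last by lra.
    by rewrite ler_piMr ?divr_ge0 ?subr_ge0 ?(ltW rc) // invf_le1 ?ler1n.
  have hbe k : opitv a b (be k).
    rewrite bE; split; last by rewrite lte_fin.
    by case: hc => + _; move=> /lt_trans; apply; rewrite lte_fin.
  have be_cvg : be k @[k --> \oo] --> r.
    rewrite -[X in _ --> X]subr0; apply: cvgB; first exact: cvg_cst.
    by rewrite -[X in _ --> X](mulr0 ((r - c) / 2)); apply: cvgMl_tmp; exact: cvg_harmonic.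
  have be_left : be k @[k --> \oo] --> r^'-.
    move=> P hP; have h : \forall y \near r, y < r -> P y by exact: hP.
    have [N _ HN] := be_cvg _ h; exists N => // k /HN hk; exact: hk (be_lt k).
  exists be; split=> // [k|t [_ rt]|q]; first by rewrite -bE.
    by move: rt; rewrite lte_fin => rt; near=> k; apply: ltW; near: k; exact: cvgr_gt be_cvg _ rt.
  have h0 : w (be k) / (r - be k) @[k --> \oo] --> (0 : R).
    exact: (cvg_comp _ _ be_left (approximating_right hw bE)).
  have h1 : (q.[be k] * ((w (be k) / (r - be k)) * (r - be k))) @[k --> \oo] --> q.[r] * (0 * (r - r)).
    apply: cvgM; last by apply: cvgM => //; apply: cvgB (cvg_cst _) be_cvg.
    by apply: continuous_cvg be_cvg; exact: continuous_horner.
  rewrite mul0r mulr0 in h1; apply: cvg_trans h1; apply: near_eq_cvg.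
  near=> k; rewrite divfK // subr_eq0 gt_eqF //.
- have [M hM] := admissible_decay (approximating_admissible hw) (approximating_gt0 hw hc).
  pose t := Order.max (Order.max (M + 1) 1) (c + 1).
  have tc : c < t by rewrite /t lt_max; apply/orP; right; lra.
  have tM : M + 1 <= t by rewrite /t !le_max lexx.
  have t1 : 1 <= t by rewrite /t !le_max lexx orbT.
  have high u : c <= u -> opitv a b u.
    move=> uc; rewrite bE; split; last exact: ltry.
    by case: hc => + _; move=> /lt_le_trans; apply; rewrite lee_fin.
  have ht := high t (ltW tc).
  have s0 : logder w t < 0.
    rewrite ltNge; apply/negP => s0.
    have := hM t (subset_closure ht).
    have tn : `|t| = t by rewrite ger0_norm //; lra.
    have wt := approximating_gt0 hw ht.
    rewrite tn => h; have {}h : t * w t < w c by apply: h; lra.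
    have : w c <= w t.
      apply: le_trans (weight_tangent hw ht hc) _.
      by rewrite ler_piMr ?(ltW wt) // expR_le1 mulr_ge0_le0 // subr_le0 ltW.
    by nra.
  pose be (k : nat) := t + k.+1%:R.
  have tbe k : t < be k by rewrite /be ltrDl.
  have hbe k : opitv a b (be k) by apply: high; exact/ltW/(lt_trans tc).
  have ben k : `|be k - t| = k.+1%:R by rewrite /be addrAC subrr add0r normr_nat.
  exists be; split; rewrite -?bE //.
  + by move=> k; exact: lt_trans tc (tbe k).
  + move=> u _; near=> k; rewrite /be -lerBlDl.
    by apply: (@le_trans _ _ k%:R); [near: k; exact: nbhs_infty_ger|rewrite ler_nat].
  + move=> q; apply: (@weight_seq_decay q t (- logder w t)) => // [|k|k]; first by rewrite oppr_gt0.
      by rewrite ben /be addrAC subrr add0r mulNr opprK.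
    by rewrite ben.
Unshelve. all: by end_near. Qed.

End Ends.

(** * Integrals of polynomials against the weight *)

Lemma size_sub_lead (R : realType) (r q : {poly R}) k : size r = k.+1 -> (size q <= k.+1)%N ->
  (size (q - (q`_k / lead_coef r) *: r)%R <= k)%N.
Proof.
move=> sr sq; have r0 : lead_coef r != 0 by rewrite lead_coef_eq0 -size_poly_eq0 sr.
apply/leq_sizeP => j; rewrite coefB coefZ leq_eqVlt => /orP[/eqP<-|kj].
  by have -> : r`_k = lead_coef r by [rewrite lead_coefE sr]; rewrite divfK ?subrr.
have -> : q`_j = 0 by rewrite nth_default // (leq_trans sq).
by rewrite [r`_j]nth_default ?sr // mulr0 subrr.
Qed.

Section Pairing.
Variables (R : realType) (a b : \bar R) (w : R -> R).
Hypothesis hw : approximating a b w.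
Local Notation mu := (@lebesgue_measure R).

Lemma open_opitv : open (opitv a b).
Proof. by rewrite openE => t /near_opitv. Qed.

Lemma measurable_opitv : measurable (opitv a b : set (measurableTypeR R)).
Proof. by apply: open_measurable; exact: open_opitv. Qed.

Lemma opitv_measurable_fun (f : R -> R) : (forall t, opitv a b t -> {for t, continuous f}) ->
  measurable_fun (opitv a b) f.
Proof.
move=> hf; apply: open_continuous_measurable_fun; first exact: open_opitv.
by move=> t /set_mem/hf.
Qed.

Lemma weight_measurable : measurable_fun (opitv a b) w.
Proof.
by apply: opitv_measurable_fun => t /(weight_is_derive hw); exact: is_derive_continuous.
Qed.

Lemma poly_measurable (q : {poly R}) (D : set R) : measurable_fun D (horner q).
Proof.
by apply: measurable_funTS; apply: continuous_measurable_fun; exact: continuous_horner.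
Qed.

Lemma poly_weight_integrable (q : {poly R}) :
  mu.-integrable (opitv a b) (EFin \o (fun t => q.[t] * w t)).
Proof.
have mono i : mu.-integrable (opitv a b) (EFin \o (fun t => 'X^i.[t] * w t)).
  apply: le_integrable (approximating_moments hw i); first exact: measurable_opitv.
    apply/measurable_EFinP; apply: measurable_funM; first exact: poly_measurable.
    exact: weight_measurable.
  move=> t _; rewrite /= lee_fin hornerXn normrM normrX.
  by rewrite normrM normrX normr_id.
pose h (i : 'I_(size q)) (t : measurableTypeR R) : \bar R := ((q`_i)%:E * ('X^i.[t] * w t)%:E)%E.
have H : mu.-integrable (opitv a b) (fun t => (\sum_(i < size q) h i t)%E).
  have hi i : mu.-integrable (opitv a b) (h i).
    by apply: (integrableZl measurable_opitv); exact: mono.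
  exact: (integrable_sum measurable_opitv _ (fun i _ => hi i)).
apply: eq_integrable H; first exact: measurable_opitv.
move=> t _; rewrite /= horner_coef mulr_suml -sumEFin; apply: eq_bigr => i _.
by rewrite /h hornerXn -EFinM mulrA.
Qed.

Definition pairing (q : {poly R}) : R := \int[mu]_(t in opitv a b) (q.[t] * w t).

Lemma pairingD q r : pairing (q + r) = pairing q + pairing r.
Proof.
rewrite /pairing -RintegralD; first last.
- exact: poly_weight_integrable.
- exact: poly_weight_integrable.
- exact: measurable_opitv.
by apply: eq_Rintegral => t _; rewrite hornerD mulrDl.
Qed.

Lemma pairingZ k q : pairing (k *: q) = k * pairing q.
Proof.
rewrite /pairing -RintegralZl; first last.
- exact: poly_weight_integrable.
- exact: measurable_opitv.
by apply: eq_Rintegral => t _; rewrite hornerZ mulrA.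
Qed.

(** Removing leading terms one by one expands [q] in the [p k] with [k < m], each orthogonal to
    [p m]. *)
Lemma pairing_orthogonal (p : nat -> {poly R}) m (q : {poly R}) : orthonormal_polys a b w p -> (size q <= m)%N ->
  pairing (p m * q) = 0.
Proof.
move=> hp sq; suff h k : (k <= m)%N -> forall q : {poly R}, (size q <= k)%N -> pairing (p m * q) = 0.
  exact: h sq.
elim: k => [_ r|k IH km r sr].
  rewrite leqn0 size_poly_eq0 => /eqP->.
  by rewrite mulr0 -(scale0r 0) pairingZ mul0r.
have sp := orthonormal_size hp k; pose c := r`_k / lead_coef (p k).
have -> : r = c *: p k + (r - c *: p k) by rewrite addrC subrK.
rewrite mulrDr pairingD -scalerAr pairingZ.
have -> : pairing (p m * p k) = 0.
  have := orthonormal_int hp m k; rewrite (gtn_eqF km) mulr0n; apply: etrans.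
  by apply: eq_Rintegral => t _; rewrite hornerM.
rewrite mulr0 add0r; apply: IH; first exact: ltnW.
exact: size_sub_lead.
Qed.

(** Dominated convergence with bound [|f|]: every point of the interval eventually lies in the
    segments. *)
Lemma trunc_cvg (al be : nat -> R) (f : R -> R) :
  (forall k, opitv a b (al k)) -> (forall k, opitv a b (be k)) ->
  (forall t, opitv a b t -> \forall k \near \oo, al k <= t) ->
  (forall t, opitv a b t -> \forall k \near \oo, t <= be k) ->
  mu.-integrable (opitv a b) (EFin \o f) ->
  (\int[mu]_(t in `[al k, be k]) f t) @[k --> \oo] --> \int[mu]_(t in opitv a b) f t.
Proof.
move=> hal hbe al_le be_ge fi.
have sub k : `[al k, be k] `<=` opitv a b.
  by move=> t /=; rewrite in_itv /= => /andP[h1 h2]; exact: opitv_le (hal k) (hbe k) h1 h2.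
have /integrableP[mf _] := fi.
have mI := measurable_opitv.
pose f_ k := (EFin \o f) \_ `[al k, be k].
have intE k : (\int[mu]_(t in `[al k, be k]) (f t)%:E = \int[mu]_(t in opitv a b) f_ k t)%E.
  by rewrite -integral_mkcondr setIidr.
have [|||||] := @dominated_convergence _ _ _ mu _ mI f_ (EFin \o f) (fun t => `|(f t)%:E|%E).
- move=> k; have mK : measurable (`[al k, be k] : set R) by exact: measurable_itv.
  apply: (iffLR (measurable_restrict (D := `[al k, be k]) (E := opitv a b) _ mK mI)).
  by apply: measurable_funS mf => // t [].
- exact: mf.
- apply: aeW => t ht; apply: cvg_near_cst; near=> k.
  rewrite /f_ patchE mem_set //= in_itv /=; apply/andP; split.
    by near: k; exact: al_le.
  by near: k; exact: be_ge.
- exact: (integrable_abse fi).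
- apply: aeW => t k ht; rewrite /f_ patchE; case: ifP => // _.
  by rewrite abse0.
move=> _ _ h; rewrite /Rintegral.
have fin : (\int[mu]_(t in opitv a b) (f t)%:E \is a fin_num)%E.
  by apply: integrable_fin_num.
apply: fine_cvg; rewrite fineK //; apply: cvg_trans h; apply: near_eq_cvg.
by apply: nearW => k; rewrite intE.
Unshelve. all: by end_near. Qed.

Lemma deriv_weight_continuous t : opitv a b t -> {for t, continuous (w^`()%classic)}.
Proof.
move=> /(approximating_derivable hw)[_ d2].
exact: is_derive_continuous (derive1_is_derive d2).
Qed.

Lemma within_itv_continuous (f : R -> R) (c d : R) : opitv a b c -> opitv a b d ->
  (forall t, opitv a b t -> {for t, continuous f}) -> {within `[c, d], continuous f}.
Proof.
move=> hc hd hf; apply: continuous_in_subspaceT => t /set_mem /=; rewrite in_itv /= => /andP[ct td].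
exact: hf (opitv_le hc hd ct td).
Qed.

Lemma poly_weight_is_derive (r : {poly R}) t : opitv a b t ->
  is_derive t 1 (fun s => r.[s] * w s) (r^`().[t] * w t + r.[t] * w^`()%classic t).
Proof.
move=> ht; have h := weight_is_derive hw ht.
exact: (is_derive1M (is_derive_poly r t) h).
Qed.

Lemma poly_weight_FTC (r : {poly R}) (c d : R) : opitv a b c -> opitv a b d -> c < d ->
  \int[mu]_(t in `[c, d]) (r^`().[t] * w t + r.[t] * w^`()%classic t) =
  r.[d] * w d - r.[c] * w c.
Proof.
move=> hc hd cd.
have dF t : opitv a b t -> _ := @poly_weight_is_derive r t.
have cF t : opitv a b t -> {for t, continuous (fun s => r.[s] * w s)}.
  by move=> /dF; exact: is_derive_continuous.
rewrite /Rintegral (@continuous_FTC2 _ _ (fun s => r.[s] * w s)) //.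
- apply: within_itv_continuous hc hd _ => t ht.
  have cw := is_derive_continuous (weight_is_derive hw ht).
  have cw' := deriv_weight_continuous ht.
  by apply: cvgD; apply: cvgM => //; exact: continuous_horner.
- have /(continuous_within_itvP _ cd)[_ h1 h2] := within_itv_continuous hc hd cF.
  split=> // t; rewrite in_itv /= => /andP[ct td].
  have h := dF t (opitv_le hc hd (ltW ct) (ltW td)); exact: ex_derive.
- move=> t; rewrite in_itv /= => /andP[ct td].
  by rewrite derive1E; have [_ ->] := dF t (opitv_le hc hd (ltW ct) (ltW td)).
Qed.

Lemma itv_integrable (f : R -> R) (c d : R) : opitv a b c -> opitv a b d ->
  (forall t, opitv a b t -> {for t, continuous f}) ->
  mu.-integrable `[c, d] (EFin \o f).
Proof.
move=> hc hd hf; apply: continuous_compact_integrable; first exact: segment_compact.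
exact: within_itv_continuous.
Qed.

(* Working on [[al k, be k]] avoids having to know that [q w'] is integrable on
   the whole interval. *)
Lemma trunc_ibp (al be : nat -> R) (q : {poly R}) (m : R) :
  (forall k, opitv a b (al k)) -> (forall k, opitv a b (be k)) ->
  (forall k, al k < be k) ->
  (forall t, opitv a b t -> \forall k \near \oo, al k <= t) ->
  (forall t, opitv a b t -> \forall k \near \oo, t <= be k) ->
  (q.[al k] * w (al k)) @[k --> \oo] --> (0 : R) ->
  (q.[be k] * w (be k)) @[k --> \oo] --> (0 : R) ->
  (\int[mu]_(t in `[al k, be k]) (q.[t] * w t * (m - logder w t))) @[k --> \oo] -->
  pairing q^`() + m * pairing q.
Proof.
move=> hal hbe albe al_le be_ge qal qbe.
have c1 (r : {poly R}) t : opitv a b t -> {for t, continuous (fun s => r.[s] * w s)}.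
  by move=> /(@poly_weight_is_derive r); exact: is_derive_continuous.
have c2 t : opitv a b t ->
    {for t, continuous (fun s => q^`().[s] * w s + q.[s] * w^`()%classic s)}.
  move=> ht; have cw := is_derive_continuous (weight_is_derive hw ht).
  have cw' := deriv_weight_continuous ht.
  by apply: cvgD; apply: cvgM => //; exact: continuous_horner.
(* This integrates [q w (m - w'/w) = q' w + m q w - (q w)']; the last bracket is the boundary term,
   which tends to 0. *)
have E k : \int[mu]_(t in `[al k, be k]) (q.[t] * w t * (m - logder w t)) =
    \int[mu]_(t in `[al k, be k]) (q^`().[t] * w t) +
    m * \int[mu]_(t in `[al k, be k]) (q.[t] * w t) -
    (q.[be k] * w (be k) - q.[al k] * w (al k)).
  have mK : measurable (`[al k, be k] : set R) by exact: measurable_itv.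
  rewrite -poly_weight_FTC // -RintegralZl //; last exact: itv_integrable (hal k) (hbe k) (c1 q).
  rewrite -RintegralD //; first last.
  - by apply: itv_integrable => // t ht; apply: cvgMl_tmp; exact: c1.
  - exact: itv_integrable (hal k) (hbe k) (c1 _).
  rewrite -RintegralB //; first last.
  - exact: itv_integrable (hal k) (hbe k) c2.
  - by apply: itv_integrable => // t ht; apply: cvgD; [exact: c1|apply: cvgMl_tmp; exact: c1].
  apply: eq_Rintegral => t /set_mem /=; rewrite in_itv /= => /andP[h1 h2].
  have wn0 := weight_neq0 hw (opitv_le (hal k) (hbe k) h1 h2).
  by rewrite /logder; field.
rewrite (eq_fun E) -[X in _ --> X]subr0 -[X in _ - X](subr0 0).
apply: cvgB; last exact: cvgB.
apply: cvgD; last apply: cvgMl_tmp; apply: trunc_cvg => //; exact: poly_weight_integrable.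
Qed.

End Pairing.

(** * Zeros of orthogonal polynomials *)

Section Zeros.
Variables (R : realType) (a b : \bar R).

Lemma no_root_sign (q : {poly R}) : (forall t, opitv a b t -> ~~ root q t) ->
  (forall t, opitv a b t -> 0 <= q.[t]) \/ (forall t, opitv a b t -> q.[t] <= 0).
Proof.
move=> nr; have [|/existsNP[u /not_implyP[hu qu]]] := pselect (forall t, opitv a b t -> 0 <= q.[t]).
  by left.
right=> v hv; rewrite leNgt; apply/negP => qv; move/negP: qu; rewrite -ltNge => qu.
have [uv|/ltW vu] := leP u v.
  have [|y /andP[uy yv]] := poly_ivt (p := q) uv; first by rewrite (ltW qu) ltW.
  exact/negP/nr/(opitv_le hu hv).
have [|y /andP[vy yu]] := poly_ivt (p := - q) vu.
  by rewrite !hornerN oppr_le0 oppr_ge0 (ltW qu) ltW.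
by rewrite rootN; exact/negP/nr/(opitv_le hv hu).
Qed.

(* [s] lists the roots of odd multiplicity. *)
Lemma poly_sign (q : {poly R}) : q != 0 -> exists s : seq R,
  [/\ uniq s, forall y, y \in s -> opitv a b y /\ root q y &
    let F := q * \prod_(y <- s) ('X - y%:P) in
    (forall t, opitv a b t -> 0 <= F.[t]) \/ (forall t, opitv a b t -> F.[t] <= 0)].
Proof.
elim: {q}_.+1 {-2}q (ltnSn (size q)) => // m IH q sq q0.
have [[y [hy]]|nr] := pselect (exists y, opitv a b y /\ root q y); last first.
  exists [::]; split=> //; rewrite big_nil mulr1; apply: no_root_sign => t ht.
  by apply/negP => rt; apply: nr; exists t.
move=> /factor_theorem[r qE].
have r0 : r != 0 by apply: contraNneq q0 => E; rewrite qE E mul0r.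
have [|//|s [us hs /= sgn]] := IH r.
  by move: sq; rewrite qE size_Mmonic ?monicXsubC // size_XsubC addn2.
have rq t : root r t -> root q t by move=> rt; rewrite qE rootM rt.
(* Extracting [X - y] flips the parity of the multiplicity of [y]: a listed [y] leaves the list, an
   unlisted one enters it, and then the product only gains the factor [(t - y)^2]. *)
have [ys|ys] := boolP (y \in s).
  exists (rem y s); split; first exact: rem_uniq.
    by move=> t /mem_rem/hs[? /rq].
  have -> : q * \prod_(t <- rem y s) ('X - t%:P) = r * \prod_(t <- s) ('X - t%:P).
    by rewrite qE -mulrA [in RHS](big_rem y ys).
  exact: sgn.
exists (y :: s); split=> /=; first by rewrite ys us.
  move=> t; rewrite inE => /orP[/eqP->|/hs[? /rq]//].
  by split=> //; rewrite qE rootM root_XsubC eqxx orbT.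
have FE t : (q * \prod_(t <- y :: s) ('X - t%:P)).[t] =
    (t - y) ^+ 2 * (r * \prod_(t <- s) ('X - t%:P)).[t].
  by rewrite big_cons qE !hornerM hornerXsubC; ring.
case: sgn => sgn; [left|right] => t ht; rewrite FE.
  by rewrite mulr_ge0 ?sqr_ge0 // sgn.
by rewrite mulr_ge0_le0 ?sqr_ge0 // sgn.
Qed.

Variables (w : R -> R) (p : nat -> {poly R}).
Hypotheses (hw : approximating a b w) (hp : orthonormal_polys a b w p).

Lemma pairing_ge0 (F : {poly R}) : (forall t, opitv a b t -> 0 <= F.[t]) ->
  0 <= pairing a b w F.
Proof.
move=> F0; apply: Rintegral_ge0 => t ht; rewrite mulr_ge0 ?F0 //.
exact/ltW/(approximating_gt0 hw).
Qed.

(** In the orthonormal basis the pairing of [F * F] is the sum of the squared coefficients, which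
    therefore vanish one by one from the top. *)
Lemma pairing_sqr_eq0 (F : {poly R}) : pairing a b w (F * F) = 0 -> F = 0.
Proof.
elim: {F}(size F) {-2}F (leqnn (size F)) => [F|k IH F sF F0].
  by rewrite leqn0 size_poly_eq0 => /eqP.
have sp := orthonormal_size hp k; pose c := F`_k / lead_coef (p k); pose G := F - c *: p k.
have FE : F = c *: p k + G by rewrite addrC subrK.
have sG : (size G <= k)%N := size_sub_lead sp sF.
have pp : pairing a b w (p k * p k) = 1.
  have := orthonormal_int hp k k; rewrite eqxx mulr1n; apply: etrans.
  by apply: eq_Rintegral => t _; rewrite hornerM.
have G0 : 0 <= pairing a b w (G * G).
  by apply: pairing_ge0 => t _; rewrite hornerM -expr2 sqr_ge0.
move: F0.
have -> : F * F = (c ^+ 2) *: (p k * p k) + ((2 * c) *: (p k * G) + G * G).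
  rewrite FE -!mul_polyC polyCM polyC_exp polyC_natr; ring.
rewrite (pairingD hw) (pairingD hw) !(pairingZ hw) pp (pairing_orthogonal hw hp) // mulr0 add0r mulr1.
move=> E; have [c0 GG] : c ^+ 2 = 0 /\ pairing a b w (G * G) = 0.
  have := sqr_ge0 c; split; lra.
move/eqP: c0; rewrite sqrf_eq0 => /eqP c0.
by rewrite FE c0 scale0r add0r; exact: IH.
Qed.

(* [F (1 - e F)^2 >= 0] for all [e] forces the pairing of [F^2] to vanish. *)
Lemma pairing_eq0 (F : {poly R}) : (forall t, opitv a b t -> 0 <= F.[t]) ->
  pairing a b w F = 0 -> F = 0.
Proof.
move=> F0 LF; apply: pairing_sqr_eq0; set A := pairing a b w (F * F).
have A0 : 0 <= A by apply: pairing_ge0 => t _; rewrite hornerM -expr2 sqr_ge0.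
set B := pairing a b w (F * F * F).
have B0 : 0 <= B.
  by apply: pairing_ge0 => t ht; rewrite !hornerM -expr2 mulr_ge0 ?sqr_ge0 // F0.
have key e : 0 <= - (2 * e) * A + e ^+ 2 * B.
  have -> : - (2 * e) * A + e ^+ 2 * B = pairing a b w (F * (1 - e *: F) ^+ 2).
    have -> : F * (1 - e *: F) ^+ 2 = F + ((- (2 * e)) *: (F * F) + (e ^+ 2) *: (F * F * F)).
      rewrite -!mul_polyC polyCN polyCM polyC_exp polyC_natr; ring.
    by rewrite (pairingD hw) (pairingD hw) !(pairingZ hw) LF add0r.
  apply: pairing_ge0 => t ht; rewrite hornerM mulr_ge0 ?F0 // horner_exp sqr_ge0 //.
apply/eqP; rewrite eq_le A0 andbT leNgt; apply/negP => Apos.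
have B1 : 0 < B + 1 by lra.
(* This [e] is small enough for the negative linear term to win; [B + 1] is positive even for
   [B = 0]. *)
have := key (A / (B + 1)).
have -> : - (2 * (A / (B + 1))) * A + (A / (B + 1)) ^+ 2 * B =
    - (A ^+ 2 * (B + 2)) / (B + 1) ^+ 2 by have := lt0r_neq0 B1 => nz; field.
rewrite pmulr_lge0 ?invr_gt0 ?exprn_gt0 // oppr_ge0 leNgt => /negP; apply.
by rewrite mulr_gt0 ?exprn_gt0 //; lra.
Qed.

(** With fewer than [n] zeros of odd multiplicity, their product [P] would be orthogonal to [p n],
    although [p n * P] has constant sign and is not zero. *)
Lemma orthogonal_zeros n : exists z : 'I_n -> R,
  [/\ injective z, forall k, opitv a b (z k) & forall k, (p n).[z k] = 0].
Proof.
have p0 : p n != 0 by rewrite -size_poly_eq0 (orthonormal_size hp).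
have [s [us hs /= sgn]] := poly_sign p0.
set P := \prod_(y <- s) ('X - y%:P) in sgn.
have P0 : P != 0 by rewrite monic_neq0 // monic_prod_XsubC.
have [ns|sn] := leqP n (size s); last first.
  have L0 : pairing a b w (p n * P) = 0.
    by apply: (pairing_orthogonal hw hp); rewrite /P size_prod_XsubC.
  have /eqP : p n * P = 0.
    case: sgn => sgn; first exact: pairing_eq0.
    apply/eqP; rewrite -oppr_eq0; apply/eqP; apply: pairing_eq0.
      by move=> t /sgn; rewrite hornerN oppr_ge0.
    by rewrite -scaleN1r (pairingZ hw) L0 mulr0.
  by rewrite mulf_eq0 (negbTE p0) (negbTE P0).
have ks (k : 'I_n) : (k < size s)%N by exact: leq_trans (ltn_ord k) ns.
exists (fun k => s`_k); split=> [i j /eqP|k|k].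
- by rewrite nth_uniq // => /eqP/val_inj.
- by have [] := hs _ (mem_nth 0 (ks k)).
- by have [_ /eqP] := hs _ (mem_nth 0 (ks k)).
Qed.

End Zeros.

(** * The integral in [An] and its value at the zeros of [p n] *)

Section ChristoffelKernel.
Variables (R : realType) (a b : \bar R) (w : R -> R).
Hypothesis hw : approximating a b w.
Local Notation mu := (@lebesgue_measure R).

(** The integrand of [An] with [- logder w] for [Q']; at [s = x] the quotient is 0 by division by
    zero. *)
Definition slope_integrand (P : {poly R}) (x s : R) : R :=
  P.[s] ^+ 2 * w s * ((logder w x - logder w s) / (s - x)).

Definition slope_integral (P : {poly R}) (x : R) : R :=
  \int[mu]_(s in opitv a b) slope_integrand P x s.

Lemma slope_ge0 x s : opitv a b x -> opitv a b s ->
  0 <= (logder w x - logder w s) / (s - x).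
Proof.
move=> hx hs; have [xs|/ltW sx] := leP x s.
  by rewrite divr_ge0 ?subr_ge0 // (logder_anti hw).
by rewrite -mulrNN -invrN !opprB divr_ge0 ?subr_ge0 // (logder_anti hw).
Qed.

Lemma slope_integrand_ge0 P x s : opitv a b x -> opitv a b s ->
  0 <= slope_integrand P x s.
Proof.
move=> hx hs; rewrite mulr_ge0 ?slope_ge0 // mulr_ge0 ?sqr_ge0 //.
exact/ltW/(approximating_gt0 hw).
Qed.

(** The quotient need not be continuous at [x], so this point is split off. *)
Lemma slope_integrand_measurable P x : opitv a b x ->
  measurable_fun (opitv a b) (slope_integrand P x).
Proof.
move=> hx; have -> : opitv a b = (opitv a b `&` ~` [set x]) `|` [set x].
  apply/seteqP; split=> t /=; last by case=> [[]//|->].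
  by move=> ht; have [->|/eqP tx] := eqVneq t x; [right|left].
have oI : open (opitv a b `&` ~` [set x]).
  by apply: openI; [exact: open_opitv|apply/closed_openC/accessible_closed_set1/hausdorff_accessible; exact: Rhausdorff].
apply/measurable_funU; [exact: open_measurable|exact: measurable_set1|].
split; last exact: measurable_fun_set1.
apply: open_continuous_measurable_fun => // t /set_mem[ht /eqP tx].
have cw := is_derive_continuous (weight_is_derive hw ht).
have cl := is_derive_continuous (derive1_is_derive (logder_derivable hw ht)).
have -> : slope_integrand P x =
    fun s => (P ^+ 2).[s] * w s * ((logder w x - logder w s) / (s - x)).
  by apply/funext => s; rewrite /slope_integrand horner_exp.
apply: cvgM; first by apply: cvgM => //; exact: continuous_horner.
apply: cvgM; first by apply: cvgB => //; exact: cvg_cst.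
by apply: cvgV; [rewrite subr_eq0|apply: cvgB => //; exact: cvg_cst].
Qed.

(** The integrand is nonnegative, and an infinite integral would be given the real value 0. *)
Lemma slope_integrable P x : opitv a b x -> slope_integral P x != 0 ->
  mu.-integrable (opitv a b) (EFin \o slope_integrand P x).
Proof.
move=> hx J0; apply/integrableP; split.
  by apply/measurable_EFinP; exact: slope_integrand_measurable.
rewrite ltey; apply: contra_neq J0 => Joo.
rewrite /slope_integral /Rintegral.
have -> : (\int[mu]_(s in opitv a b) (slope_integrand P x s)%:E =
    \int[mu]_(s in opitv a b) `|(EFin \o slope_integrand P x) s|)%E.
  apply: eq_integral => s /set_mem hs.
  by rewrite /= ger0_norm // slope_integrand_ge0.
by rewrite Joo.
Qed.

(** One exhaustion by segments serves both integrals, so comparisons on segments pass to the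
    limit. *)
Lemma slope_integral_trunc (P q : {poly R}) x : opitv a b x -> slope_integral P x != 0 ->
  exists al be : nat -> R,
  [/\ forall k, opitv a b (al k), forall k, opitv a b (be k),
    (\int[mu]_(s in `[al k, be k]) slope_integrand P x s) @[k --> \oo] --> slope_integral P x &
    (\int[mu]_(s in `[al k, be k]) (q.[s] * w s * (logder w x - logder w s))) @[k --> \oo] -->
      pairing a b w q^`() + logder w x * pairing a b w q].
Proof.
move=> hx J0.
have [al [hal alx al_le qal]] := left_end hw hx.
have [be [hbe xbe be_ge qbe]] := right_end hw hx.
exists al, be; split=> //.
  by apply: trunc_cvg => //; exact: slope_integrable.
by apply: trunc_ibp => // k; exact: lt_trans (alx k) (xbe k).
Qed.

(** The polynomial bound is multiplied by [w] and the nonnegative slope quotient; integration by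
    parts evaluates the smaller integral. *)
Lemma slope_integral_ge (P q : {poly R}) x : opitv a b x -> slope_integral P x != 0 ->
  (forall s, q.[s] * (s - x) <= P.[s] ^+ 2) ->
  pairing a b w q^`() + logder w x * pairing a b w q <= slope_integral P x.
Proof.
move=> hx J0 qP; have [al [be [hal hbe c1 c2]]] := slope_integral_trunc q hx J0.
apply: ler_cvg_to c2 c1 _; apply: nearW => k.
have mK : measurable (`[al k, be k] : set R) by exact: measurable_itv.
apply: le_Rintegral => //.
- apply: itv_integrable => // t ht.
  have cw := is_derive_continuous (weight_is_derive hw ht).
  have cl := is_derive_continuous (derive1_is_derive (logder_derivable hw ht)).
  apply: cvgM; first by apply: cvgM => //; exact: continuous_horner.
  by apply: cvgB => //; exact: cvg_cst.
- apply: integrableS (slope_integrable hx J0) => //; first exact: measurable_opitv.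
  by move=> t /=; rewrite in_itv /= => /andP[h1 h2]; exact: opitv_le (hal k) (hbe k) h1 h2.
move=> s; rewrite /= in_itv /= => /andP[h1 h2].
have hs := opitv_le (hal k) (hbe k) h1 h2.
have ws := approximating_gt0 hw hs.
rewrite /slope_integrand; have [->|sx] := eqVneq s x; first by rewrite !subrr !mul0r !mulr0.
have -> : q.[s] * w s * (logder w x - logder w s) =
    q.[s] * (s - x) * w s * ((logder w x - logder w s) / (s - x)).
  have nz : s - x != 0 by rewrite subr_eq0.
  by field.
by rewrite ler_wpM2r ?slope_ge0 // ler_wpM2r ?(ltW ws).
Qed.

Lemma slope_integral_eq (P q : {poly R}) x : opitv a b x -> slope_integral P x != 0 ->
  (forall s, q.[s] * (s - x) = P.[s] ^+ 2) ->
  slope_integral P x = pairing a b w q^`() + logder w x * pairing a b w q.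
Proof.
move=> hx J0 qP; have [al [be [hal hbe c1 c2]]] := slope_integral_trunc q hx J0.
suff E k : \int[mu]_(s in `[al k, be k]) slope_integrand P x s =
    \int[mu]_(s in `[al k, be k]) (q.[s] * w s * (logder w x - logder w s)).
  by rewrite (eq_fun E) in c1; rewrite -(cvg_lim _ c1) // (cvg_lim _ c2).
apply: eq_Rintegral => s _; rewrite /slope_integrand -qP.
have [->|sx] := eqVneq s x; first by rewrite !subrr !mul0r !mulr0.
have nz : s - x != 0 by rewrite subr_eq0.
by field.
Qed.

Variables (p : nat -> {poly R}) (n : nat) (x : 'I_n -> R).
Hypotheses (hp : orthonormal_polys a b w p) (n0 : (0 < n)%N).
Hypotheses (injx : injective x) (hx : forall k, opitv a b (x k)).
Hypothesis (px : forall k, (p n).[x k] = 0).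
Hypothesis J0 : forall t, opitv a b t -> slope_integral (p n) t != 0.

Local Notation L := (pairing a b w).

Lemma orthogonal_omega : p n = lead_coef (p n) *: omega x.
Proof.
have -> : omega x = \prod_(z <- [seq x k | k <- index_enum 'I_n]) ('X - z%:P).
  by rewrite big_map.
apply: all_roots_prod_XsubC.
- by rewrite (orthonormal_size hp) size_map /index_enum -enumT size_enum_ord.
- by apply/allP => _ /mapP[k _ ->]; apply/eqP.
- by rewrite uniq_rootsE map_inj_uniq // index_enum_uniq.
Qed.

(* With [g = p / (X - x k)], the bound [p^2 >= g^2 (X - x k + d) (X - t)], where
   [d = t - x k], makes [slope_integral (p n)] lie above a function of [t] whose
   value and derivative at [x k] are read off from the orthogonality of [p n]. *)
Lemma slope_integral_at_zero k (J' : R) :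
  is_derive (x k) 1 (slope_integral (p n)) J' ->
  (forall t, opitv a b t -> derivable (slope_integral (p n)) t 1) ->
  J' / slope_integral (p n) (x k) = 2 * inv_gaps x k + logder w (x k).
Proof.
move=> dJ dJt; pose xk := x k; pose g := lead_coef (p n) *: omega_but x k.
have lc0 := lt0r_neq0 (orthonormal_lead hp n).
have pE : p n = ('X - xk%:P) * g by rewrite orthogonal_omega (omega_butE x k) scalerAr.
have sg : size g = n by rewrite size_scale // size_omega_but.
have gn0 : g.[xk] != 0.
  by rewrite hornerZ mulf_neq0 // -deriv_omega // deriv_omega_neq0.
have g'E : g^`().[xk] = inv_gaps x k * g.[xk].
  rewrite derivZ !hornerZ deriv_prod_XsubC => [|j jk]; last by have := node_neq injx jk.
  by rewrite -/(inv_gaps x k) -/(omega_but x k); ring.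
pose M := L (g * g).
have sg' : (size g^`() <= n)%N.
  rewrite -[X in (_ <= X)%N]sg; apply: ltnW; apply: lt_size_deriv.
  by rewrite -size_poly_eq0 sg -lt0n.
have Lpg : L (p n * g^`()) = 0 by exact: (pairing_orthogonal hw hp).
(* [r] vanishes at [xk], so [g * r] is [p n] times a polynomial of degree below [n], whose pairing
   is 0. *)
have Lgg' : L (g * g^`()) = inv_gaps x k * M.
  pose r := g^`() - inv_gaps x k *: g.
  have /factor_theorem[r2 rE] : root r xk by apply/eqP; rewrite hornerD hornerN hornerZ g'E subrr.
  have : L (g * r) = 0.
    have -> : g * r = p n * r2 by rewrite rE pE; ring.
    apply: (pairing_orthogonal hw hp).
    have [->|r20] := eqVneq r2 0; first by rewrite size_poly0.
    have : (size r <= n)%N.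
      rewrite (leq_trans (size_polyD _ _)) // geq_max size_polyN.
      by rewrite sg' (leq_trans (size_scale_leq _ _)) ?sg.
    by rewrite rE size_Mmonic ?monicXsubC // size_XsubC addn2 /=; apply: leq_trans.
  rewrite /r mulrBr -scaleN1r (pairingD hw) !(pairingZ hw) -scalerAr (pairingZ hw) -/M.
  by lra.
(* For [d = t - xk], [rho d] times [X - t] is [g^2 ((X - xk)^2 - d^2)], which is at most [p^2], with
   equality for [d = 0]. *)
pose rho (d : R) := g * g * ('X - xk%:P + d%:P).
have rhoE d : rho d = p n * g + d *: (g * g).
  by rewrite /rho pE -mul_polyC; ring.
have Lrho d : L (rho d) = d * M.
  by rewrite rhoE (pairingD hw) (pairingZ hw) (pairing_orthogonal hw hp) ?sg // add0r.
have Lrho' d : L (rho d)^`() = M + d * (2 * (inv_gaps x k * M)).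
  have -> : (rho d)^`() = g * g + (2 *: (p n * g^`()) + (d * 2) *: (g * g^`())).
    rewrite rhoE pE derivD derivZ !derivM derivXsubC -!mul_polyC polyCM !polyC_natr; ring.
  by rewrite !(pairingD hw) !(pairingZ hw) Lpg Lgg' -/M; ring.
have Jge t : opitv a b t -> M + (t - xk) * (2 * (inv_gaps x k * M) + logder w t * M) <=
    slope_integral (p n) t.
  move=> ht; have := @slope_integral_ge (p n) (rho (t - xk)) t ht (J0 ht).
  rewrite Lrho Lrho' => h; apply: le_trans (h _); first by rewrite le_eqVlt; apply/orP; left; apply/eqP; ring.
  move=> s; rewrite /rho pE !(hornerM, hornerD, hornerXsubC, hornerC) hornerN hornerX hornerC.
  have := mulr_ge0 (sqr_ge0 g.[s]) (sqr_ge0 (t - xk)); nra.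
have JM : slope_integral (p n) xk = M.
  have hk : opitv a b xk by exact: hx.
  rewrite (slope_integral_eq (q := rho 0) hk (J0 hk)); first by rewrite Lrho Lrho'; ring.
  by move=> s; rewrite /rho pE !(hornerM, hornerD, hornerXsubC, hornerC) hornerN hornerX hornerC; ring.
have M0 : M != 0 by rewrite -JM J0 //; exact: hx.
pose A := fun t => M + (t - xk) * (2 * (inv_gaps x k * M) + logder w t * M).
have dA t : opitv a b t -> is_derive t 1 A ((2 * (inv_gaps x k * M) + logder w t * M) +
    (t - xk) * (logder w)^`()%classic t * M).
  move=> ht; have dl := derive1_is_derive (logder_derivable hw ht).
  have d1 : is_derive t 1 (fun s : R => s - xk) 1.
    by apply: (is_derive_eq (is_derive1B (is_derive_id _ _) (is_derive_cst _ _ _))); rewrite subr0.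
  have d2 : is_derive t 1 (fun s => 2 * (inv_gaps x k * M) + logder w s * M)
      ((logder w)^`()%classic t * M).
    apply: (is_derive_eq (is_deriveD (is_derive_cst (2 * (inv_gaps x k * M)) _ _)
      (is_derive1M dl (is_derive_cst M _ _)))).
    by rewrite mulr0 addr0 add0r.
  apply: (is_derive_eq (is_deriveD (is_derive_cst M _ _) (is_derive1M d1 d2))).
  by rewrite add0r; ring.
have dD t : opitv a b t -> derivable (fun s => A s - slope_integral (p n) s) t 1.
  by move=> ht; apply: derivableB; [have h := dA t ht; exact: ex_derive|exact: dJt].
have := local_max_derive (hx k) (is_derive1B (dA _ (hx k)) dJ) dD.
rewrite -/xk subrr !mul0r addr0 => E; have {}E : 2 * (inv_gaps x k * M) + logder w xk * M - J' = 0.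
  by apply: E => s hs; rewrite JM /A subrr mul0r addr0 subrr subr_le0 Jge.
rewrite JM; have -> : J' = 2 * (inv_gaps x k * M) + logder w xk * M by lra.
by field.
Qed.

End ChristoffelKernel.

(** * Assembling the equivalences *)

Section Equivalences.
Variables (R : realType) (a b : \bar R) (n : nat) (x : 'I_n -> R).
Hypotheses (n2 : (2 <= n)%N) (hx : forall k, opitv a b (x k)) (injx : injective x).

Lemma normal1P (mrs : R) (v : R -> R) : 0 < mrs ->
  normal1 x a b mrs v <-> (forall t, opitv a b t -> Y x v t <= 1).
Proof.
move=> m0; split=> [[L [_ _]]//|Yle].
have S0 : 0 <= \sum_(k < n) `|x k| by exact: sumr_ge0.
(* This [L] exceeds 1, and [L * mrs] exceeds the sum of all [|x k|]. *)
exists (2 + (\sum_(k < n) `|x k|) / mrs); split=> // [|k].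
  by rewrite ltr_wpDr ?divr_ge0 ?(ltW m0) // ltr1n.
rewrite mulrDl divfK ?lt0r_neq0 //.
apply: (@le_lt_trans _ _ (\sum_(k < n) `|x k|)); last by rewrite ltrDr mulr_gt0.
by rewrite (bigD1 k) //= lerDl sumr_ge0.
Qed.

Lemma economical_normal1P (mrs : R) (v : R -> R) : 0 < mrs -> approximating a b v ->
  most_economical x a b v (fun k => fund x k ^+ 2) <-> normal1 x a b mrs v.
Proof.
move=> m0 hv; have n0 : (0 < n)%N by exact: leq_trans n2.
apply: iff_trans (most_economicalP (approximating_gt0 hv) hx injx n0) _.
by apply: iff_sym; exact: normal1P.
Qed.

Lemma fejer0_economicalP (v : R -> R) : approximating a b v ->
  nderiv_ge0 a b (2 * n) (fun t => (v t)^-1) ->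
  (forall k, fejer_const x v k = 0) <->
  most_economical x a b v (fun k => fund x k ^+ 2).
Proof.
move=> hv hn; have n0 : (0 < n)%N by exact: leq_trans n2.
apply: iff_trans (Y_le1P hv hx injx n0 hn) _.
by apply: iff_sym; exact: most_economicalP (approximating_gt0 hv) hx injx n0.
Qed.

Variables (w Q : R -> R) (p : nat -> {poly R}) (wn : R -> R).
Hypotheses (hQ : forall t, opitv a b t -> w t = expR (- Q t)).
Hypotheses (hw : approximating a b w) (hp : orthonormal_polys a b w p).
Hypothesis hwn_def : forall t, opitv a b t -> wn t = w t * varrho p n / An a b w Q p n t.
Hypothesis hwn : approximating a b wn.

(** [Q] is known only through [w]: near [t] it is [- ln w], which also supplies its
    differentiability. *)
Lemma derive1_field t : opitv a b t -> Q^`()%classic t = - logder w t.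
Proof.
move=> ht; rewrite derive1E.
have h : is_derive t 1 Q (- logder w t).
  apply: (@near_eq_is_derive _ _ _ (fun s => - ln (w s))).
    near=> s; rewrite hQ ?expRK ?opprK //.
    by near: s; exact: near_opitv.
  by have hl := weight_is_derive_log hw ht; exact: is_deriveN.
by case: h.
Unshelve. all: by end_near. Qed.

Lemma varrho_neq0 : varrho p n != 0.
Proof.
by rewrite mulf_neq0 ?invr_eq0 // lt0r_neq0 // (orthonormal_lead hp).
Qed.

Lemma AnE t : opitv a b t -> An a b w Q p n t = varrho p n * slope_integral a b w (p n) t.
Proof.
move=> ht; congr (_ * _); apply: eq_Rintegral => s /set_mem hs.
by rewrite !derive1_field // opprK addrC.
Qed.

(** A vanishing integral would make [An], and by division by zero also [wn], equal to 0, against the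
    positivity of [wn]. *)
Lemma slope_integralE t : opitv a b t ->
  slope_integral a b w (p n) t != 0 /\ slope_integral a b w (p n) t = w t / wn t.
Proof.
move=> ht; have wn0 := weight_neq0 hwn ht; have w0 := weight_neq0 hw ht.
have r0 := varrho_neq0; have := hwn_def ht; rewrite AnE //.
set J := slope_integral a b w (p n) t => E.
have J0 : J != 0.
  by apply: contra_neq wn0 => J0; rewrite E J0 mulr0 invr0 mulr0.
split=> //; rewrite E; field.
by rewrite J0 r0 w0.
Qed.

(** The integral is [w / wn], with logarithmic derivative [logder w - logder wn]. Comparison with
    [slope_integral_at_zero] cancels [logder w] and leaves (A) for [wn]. *)
Lemma orthogonal_zeros_fejer (z : 'I_n -> R) : injective z ->
  (forall k, opitv a b (z k)) -> (forall k, (p n).[z k] = 0) ->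
  forall k, fejer_const z wn k = 0.
Proof.
move=> injz hz pz k.
have dJ t : opitv a b t -> is_derive t 1 (slope_integral a b w (p n))
    (w t / wn t * (logder w t - logder wn t)).
  move=> ht; apply: (@near_eq_is_derive _ _ _ (fun s => w s * (wn s)^-1)).
    near=> s; have hs : opitv a b s by near: s; exact: near_opitv.
    by have [_ ->] := slope_integralE hs.
  apply: (is_derive_eq (is_derive1M (weight_is_derive hw ht) (weight_is_deriveV hwn ht))).
  have w0 := weight_neq0 hw ht; have wn0 := weight_neq0 hwn ht.
  by rewrite /logder; field; rewrite w0 wn0.
have n0 : (0 < n)%N by exact: leq_trans n2.
have J0 t : opitv a b t -> slope_integral a b w (p n) t != 0.
  by move=> /slope_integralE[].
have dJt t : opitv a b t -> derivable (slope_integral a b w (p n)) t 1.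
  by move=> ht; have h := dJ t ht; exact: ex_derive.
have := slope_integral_at_zero hw hp n0 injz hz pz J0 (dJ _ (hz k)) dJt.
have [_ ->] := slope_integralE (hz k).
have w0 := weight_neq0 hw (hz k); have wn0 := weight_neq0 hwn (hz k).
rewrite mulrAC divff ?mul1r ?mulf_neq0 ?invr_eq0 // => E.
apply/eqP; rewrite fejer_const_eq0 //; apply/eqP; lra.
Unshelve. all: by end_near. Qed.

(** The zeros of [p n] solve (A) for [wn], and by [fejer0_unique] any other solution is a
    permutation of them. *)
Lemma fejer0_orthogonal_zeros : nderiv_ge0 a b (2 * n) (fun t => (wn t)^-1) ->
  (forall k, fejer_const x wn k = 0) -> forall k, (p n).[x k] = 0.
Proof.
move=> hn C0 k; have [z [injz hz pz]] := orthogonal_zeros hw hp n.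
have [s ->] := fejer0_unique hwn n2 hn injx injz hx hz C0 (orthogonal_zeros_fejer injz hz pz).
exact: pz.
Qed.

End Equivalences.

Theorem mainTheorem2 (R : realType) (a b : \bar R) (n : nat)
    (w Q : R -> R) (x : 'I_n -> R) (mrs mrs' : R)
    (hab : (a < b)%E) (hn : (2 <= n)%N)
    (hQ : forall t, opitv a b t -> w t = expR (- Q t))
    (hw : approximating a b w)
    (hx : forall k, opitv a b (x k)) (hinj : injective x)
    (hmrs : 0 < mrs) (hmrs' : 0 < mrs') :
  (nderiv_ge0 a b (2 * n) (fun t => (w t)^-1) ->
    [<-> forall k, fejer_const x w k = 0;
         fekete_set x a b (root_weight n w);
         most_economical x a b w (fun k => fund x k ^+ 2);
         normal1 x a b mrs w]) /\
  (forall (p : nat -> {poly R}) (wn : R -> R),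
    orthonormal_polys a b w p ->
    (forall t, opitv a b t -> wn t = w t * varrho p n / An a b w Q p n t) ->
    approximating a b wn ->
    nderiv_ge0 a b (2 * n) (fun t => (wn t)^-1) ->
    [<-> forall k, fejer_const x wn k = 0;
         fekete_set x a b (root_weight n wn);
         forall k, (p n).[x k] = 0;
         most_economical x a b wn (fun k => fund x k ^+ 2);
         normal1 x a b mrs' wn]).
Proof.
split=> [hd|p wn hp wnE hwn hd].
  have AD := fejer0_economicalP hn hx hinj hw hd.
  have DE := economical_normal1P hn hx hinj hmrs hw.
  tfae.
  - exact: fejer0_fekete.
  - by move=> /(fekete_fejer0 hw hn hx hinj)/AD.
  - by move=> /DE.
  - by move=> /DE/AD.
have AD := fejer0_economicalP hn hx hinj hwn hd.
have DE := economical_normal1P hn hx hinj hmrs' hwn.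
tfae.
- exact: fejer0_fekete.
(* A Fekete set satisfies (A) for [wn], and uniqueness then identifies it with the zeros of
   [p n]. *)
- move=> /(fekete_fejer0 hwn hn hx hinj).
  exact: (fejer0_orthogonal_zeros hn hx hinj hQ hw hp wnE hwn hd).
- move=> px; apply/AD; exact: (orthogonal_zeros_fejer hn hQ hw hp wnE hwn hinj hx px).
- by move=> /DE.
- by move=> /DE/AD.
Qed.
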